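(* There is a planar graph $H'$ on the vertex set $\mathbb{Z}^2$, all of whose edges connect vertices at Euclidean distance at most $2$, such that for any two vertices $p$ and $q$, $$d(p,q)-O(1)\le d_{H'}(p,q)=d(p,q)+o\left(d(p,q)^{5/6}\right).$$ That is, there is a constant $K$ with $d_{H'}(p,q)\ge d(p,q)-K$ for all $p,q\in\mathbb{Z}^2$, and for every $\eta>0$ there is $D$ such that $|d_{H'}(p,q)-d(p,q)|\le \eta\, d(p,q)^{5/6}$ for all $p,q\in\mathbb{Z}^2$ with $d(p,q)\ge D$.
   Context: $d(p,q)$ is the Euclidean distance. Graphs are simple and unweighted; $d_{H'}(p,q)$ is the graph distance, i.e. the minimum number of edges along a path connecting $p$ and $q$ in $H'$. *)

(* Defs.v *)
From HB Require Import structures.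
From mathcomp Require Import all_boot all_order all_algebra.
From mathcomp Require Import all_classical all_reals all_analysis.
Set Implicit Arguments.
Unset Strict Implicit.
Unset Printing Implicit Defensive.
Import Order.TTheory GRing.Theory Num.Theory.
Import numFieldNormedType.Exports.
Local Open Scope classical_set_scope.
Local Open Scope ring_scope.

Record sgraph (V : Type) := SGraph {
  adj : rel V;
  adj_sym : symmetric adj;
  adj_irrefl : irreflexive adj }.

Section GraphDistance.
Context {V : eqType}.

(* The vertices after p of a path from p to q; its length is the size of s. *)
Definition is_path (G : sgraph V) (p q : V) (s : seq V) : Prop :=
  [/\ path (adj G) p s, last p s = q & uniq (p :: s)].

(* +oo when p and q lie in different components; otherwise the infimum of
   this nonempty set of natural numbers is a minimum. *)
Definition graph_dist (R : realType) (G : sgraph V) (p q : V) : \bar R :=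
  ereal_inf [set ((size s)%:R)%:E | s in is_path G p q].

End GraphDistance.

Section Planarity.
Context {R : realType}.

Definition arc_between (a b : R * R) (A : set (R * R)) : Prop :=
  exists f : R -> R * R,
    [/\ {within `[0, 1], continuous f},
        {in `[0, 1] &, injective f},
        f 0 = a, f 1 = b & A = f @` `[0, 1]].

(* Topological plane drawing of an abstract graph: pos places the vertices and
   the undirected edge uv is drawn as the arc curve u v = curve v u.  Even when
   V is itself a set of points, pos is free. *)
Definition plane_drawing (V : eqType) (G : sgraph V)
    (pos : V -> R * R) (curve : V -> V -> set (R * R)) : Prop :=
  [/\ injective pos,
      forall u v, curve u v = curve v u,
      forall u v, adj G u v -> arc_between (pos u) (pos v) (curve u v),
      forall u v w, adj G u v -> curve u v (pos w) -> w = u \/ w = v &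
      forall u v x y, adj G u v -> adj G x y -> [set u; v] <> [set x; y] ->
        curve u v `&` curve x y `<=` pos @` ([set u; v] `&` [set x; y])].

End Planarity.

Definition planar (R : realType) (V : eqType) (G : sgraph V) : Prop :=
  exists (pos : V -> R * R) (curve : V -> V -> set (R * R)),
    plane_drawing G pos curve.

Definition eucl_dist (R : realType) (p q : int * int) : R :=
  Num.sqrt (((p.1 - q.1)%:~R) ^+ 2 + ((p.2 - q.2)%:~R) ^+ 2).

(* Main.v *)
Require Import Defs.
From HB Require Import structures.
From mathcomp Require Import all_boot all_order all_algebra.
From mathcomp Require Import all_classical all_reals all_analysis.
From mathcomp Require Import zify ring lra.
Import Order.TTheory GRing.Theory Num.Theory.
Import numFieldNormedType.Exports.
Local Open Scope classical_set_scope.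
Local Open Scope ring_scope.

(** H' lives inside the king's graph on Z^2 and never contains both diagonals of
    a unit square, so drawing its edges as straight segments is planar.  It is the
    union of a slow graph (a spanning subgraph of the unit grid in which every
    path of k steps covers Euclidean distance at most (15 k + 4) / 16) and of
    roads: staircases of n steps following a straight segment of length n.
    Distinct roads are kept far apart, so changing roads costs more than it can
    gain, while leaving and rejoining one road never pays because k steps of a road
    cover taxicab distance at least k; hence the graph distance is at least the
    Euclidean one minus a constant.

    Roads exist at all levels i.  Level i uses about 2^i directions, parallel
    lines at distance about 2^(7 i), and cuts them into chords inside the squares
    of side 4^i.  A chord is built only if no built chord of a higher level (or of
    the same level, with an earlier code) enters its square.  At distance d with
    2^(10 j) <= d < 2^(10 (j + 1)) one travels along two lines of level j whose
    directions differ by about 2^(-j): this costs a relative error 4^(-j), and the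
    missing chords cost no more, since a level j line meets few lines of levels
    between j and 2 j, and chords of level at least 2 j are long enough to be
    followed.  The total error d / 4^j is O(d^(4/5)).  The construction is
    carried out with the levels up to J only, and H' is the limit of these graphs
    along an ultrafilter as J tends to infinity. *)

(** * Walks of bounded length *)

Section Reach.
Context {R : realType} {V : eqType} (e : rel V).

(** Walks may repeat vertices and the budget is real, so that bounds compose by addition; a walk is
    cut down to a simple path only in [graph_dist_le]. *)
Definition reach (c : R) (x y : V) : Prop :=
  exists s, [/\ path e x s, last x s = y & (size s)%:R <= c].

Lemma reach_refl c x : 0 <= c -> reach c x x.
Proof. by move=> c0; exists [::]. Qed.

Lemma reach_weak c c' x y : c <= c' -> reach c x y -> reach c' x y.
Proof. by move=> cc' [s [ps ls ss]]; exists s; split=> //; exact: le_trans cc'. Qed.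

Lemma reach_adj x y : e x y -> reach 1 x y.
Proof. by move=> exy; exists [:: y]; rewrite /= exy. Qed.

Lemma reach_trans c c' y x z : reach c x y -> reach c' y z -> reach (c + c') x z.
Proof.
move=> [s [ps ls ss]] [t [pt lt st]]; exists (s ++ t).
by rewrite cat_path last_cat size_cat ls ps pt natrD lerD.
Qed.

Lemma reach_sym c x y : symmetric e -> reach c x y -> reach c y x.
Proof.
move=> esym [s [ps ls ss]]; exists (rev (belast x s)).
rewrite size_rev size_belast; split=> //.
- rewrite -ls rev_path; apply: sub_path ps => a b /=; by rewrite esym.
- case: s {ps ss} ls => [//|a s] _ /=; by rewrite rev_cons last_rcons.
Qed.

(** [E.1] is a set of steps at which the planned edge may be missing, and [E.2] is an overhead paid
    once for jumping from one of these steps past another, however long the jump. *)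
Definition excursion (x : nat -> V) (n : nat) (E : set nat * R) : Prop :=
  0 <= E.2 /\ forall i l, (i <= l < n)%N -> E.1 i -> E.1 l ->
    reach ((l.+1 - i)%:R + E.2) (x i) (x l.+1).

(* Cut the walk at its last step: if that step belongs to the excursion E, jump
   from the first step in E, after which E is never needed again. *)
Lemma reach_excursions (x : nat -> V) (n : nat) (Es : seq (set nat * R)) :
  (forall E, E \in Es -> excursion x n E) ->
  (forall i, (i < n)%N ->
     reach 1 (x i) (x i.+1) \/ exists2 E, E \in Es & E.1 i) ->
  reach (n%:R + \sum_(E <- Es) E.2) (x 0%N) (x n).
Proof.
have [k] := ubnP (size Es); elim: k n Es => // k IHk n Es sEs exE.
have S0 Fs : {subset Fs <= Es} -> 0 <= \sum_(E <- Fs) E.2.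
  by move=> sub; rewrite big_seq; apply: sumr_ge0 => E /sub /exE [].
have : (n <= n)%N by [].
move: {-2}n => b; elim: b => [|b IHb] bn cov.
  by apply: reach_refl; rewrite add0r; exact: S0.
have [good|[E EEs Eb]] := cov b (ltnSn b).
  rewrite -natr1 addrAC; apply: reach_trans good.
  by apply: IHb => [|i ib]; [exact: ltnW | apply: cov; exact: ltnW].
pose P i := `[< E.1 i >].
have exP : exists i, P i by exists b; exact/asboolP.
case: (ex_minnP exP) => i /asboolP Ei mini.
have ib : (i <= b)%N by apply: mini; exact/asboolP.
have [E0 jump] := exE _ EEs.
rewrite (perm_big _ (perm_to_rem EEs)) big_cons /=.
have -> : b.+1%:R + (E.2 + \sum_(F <- rem E Es) F.2) =
    (i%:R + \sum_(F <- rem E Es) F.2) + ((b.+1 - i)%:R + E.2) :> R.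
  by rewrite natrB ?(leq_trans ib) //; ring.
apply: reach_trans (jump i b _ Ei Eb); last by rewrite ib.
have rsub F : F \in rem E Es -> F \in Es by exact: mem_rem.
apply: IHk => [|F /rsub /exE [F0 jF]|t ti].
- by rewrite size_rem //; case: Es sEs EEs {exE S0 cov IHb rsub}.
- split=> // a l /andP[al li]; apply: jF.
  by rewrite al (leq_trans li) // (leq_trans ib) // ltnW.
have [|good|[F FEs Ft]] := cov t; first by rewrite (leq_trans ti) // (leq_trans ib).
  by left.
right; exists F => //.
have := perm_mem (perm_to_rem EEs) F; rewrite FEs inE => /esym /orP[/eqP FE|//].
have : (i <= t)%N by apply: mini; apply/asboolP; rewrite -FE.
by rewrite leqNgt ti.
Qed.

(** Different causes of missing edges can be treated separately: their excursions are collected and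
    their overheads added. *)
Definition bypassable (x : nat -> V) (n : nat) (P : set nat) (C : R) : Prop :=
  exists Es : seq (set nat * R),
    [/\ forall E, E \in Es -> excursion x n E,
        forall i, (i < n)%N -> P i -> exists2 E, E \in Es & E.1 i &
        \sum_(E <- Es) E.2 <= C].

Lemma bypassable_reach x n P C : bypassable x n P C ->
  (forall i, (i < n)%N -> reach 1 (x i) (x i.+1) \/ P i) ->
  reach (n%:R + C) (x 0%N) (x n).
Proof.
move=> [Es [ex cov SC]] good; apply: (@reach_weak (n%:R + \sum_(E <- Es) E.2)).
  by rewrite lerD2l.
by apply: reach_excursions => // i iln; case: (good i iln); [left|right; exact: cov].
Qed.

Lemma bypassableU x n P Q C D : bypassable x n P C -> bypassable x n Q D ->
  bypassable x n (P `|` Q) (C + D).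
Proof.
move=> [Es [exE covE SE]] [Fs [exF covF SF]]; exists (Es ++ Fs); split.
- by move=> E; rewrite mem_cat => /orP[/exE|/exF].
- move=> i iln [/(covE i iln)|/(covF i iln)] [E EE Ei]; exists E => //;
  by rewrite mem_cat EE ?orbT.
- by rewrite big_cat lerD.
Qed.

Lemma bypassable_weaken x n (P Q : set nat) C D : P `<=` Q -> C <= D ->
  bypassable x n Q C -> bypassable x n P D.
Proof.
move=> PQ CD [Es [exE covE SE]]; exists Es; split=> //; last exact: le_trans CD.
by move=> i iln /PQ; exact: covE.
Qed.

Lemma bypassable_bigcup x n (I : eqType) (r : seq I) (P : I -> set nat) C :
  (forall i, i \in r -> bypassable x n (P i) C) ->
  bypassable x n [set t | exists2 i, i \in r & P i t] ((size r)%:R * C).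
Proof.
elim: r => [_|i r IHr bP].
  by exists [::]; split=> // [t _ []//|]; rewrite big_nil mul0r.
have -> : [set t | exists2 a, a \in i :: r & P a t] =
    P i `|` [set t | exists2 a, a \in r & P a t].
  apply/seteqP; split=> t /=.
    by move=> [a]; rewrite inE => /orP[/eqP ->|ar] Pa; [left|right; exists a].
  move=> [Pi|[a ar Pa]]; first by exists i; rewrite ?mem_head.
  by exists a; rewrite // inE ar orbT.
rewrite /= -natr1 mulrDl mul1r addrC; apply: bypassableU.
  by apply: bP; exact: mem_head.
by apply: IHr => a ar; apply: bP; rewrite inE ar orbT.
Qed.

End Reach.

(** * Planarity of subgraphs of the king's graph *)

Definition king (p q : int * int) : bool :=
  [&& p != q, `|p.1 - q.1| <= 1 & `|p.2 - q.2| <= 1].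

Definition no_crossing (e : rel (int * int)) : Prop :=
  forall x y, e (x, y) (x + 1, y + 1) -> e (x + 1, y) (x, y + 1) -> False.

Section KingPlanar.
Context {R : realType}.

Definition emb (p : int * int) : R * R := (p.1%:~R, p.2%:~R).

Definition on_seg (u v : int * int) (t : R) : R * R :=
  (u.1%:~R + t * (v.1 - u.1)%:~R, u.2%:~R + t * (v.2 - u.2)%:~R).

Lemma on_seg0 u v : on_seg u v 0 = emb u.
Proof. by rewrite /on_seg /emb !mul0r !addr0. Qed.

Lemma on_seg1 u v : on_seg u v 1 = emb v.
Proof. by rewrite /on_seg /emb !mul1r !intrB !subrKC. Qed.

Lemma on_segC u v t : on_seg u v t = on_seg v u (1 - t).
Proof. by rewrite /on_seg !intrB; congr pair; ring. Qed.

Lemma emb_inj : injective emb.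
Proof. by move=> [a b] [c d] [] /intr_inj -> /intr_inj ->. Qed.

Lemma on_seg_inj u v : u != v -> injective (on_seg u v).
Proof.
move=> uv s t [] /addrI e1 /addrI e2.
have [d1|d1] := eqVneq (v.1 - u.1) 0; last first.
  by apply: (mulIf _ e1); rewrite intr_eq0.
have [d2|d2] := eqVneq (v.2 - u.2) 0; last first.
  by apply: (mulIf _ e2); rewrite intr_eq0.
case/negP: uv; apply/eqP; case: u v d1 d2 {e1 e2} => [a b] [c d] /= d1 d2.
by congr pair; lia.
Qed.

Lemma on_seg_arc u v : u != v ->
  arc_between (emb u) (emb v) (on_seg u v @` `[0, 1]%classic).
Proof.
move=> uv; exists (on_seg u v); split=> //.
- have aff (c k : R) : continuous (fun t : R => c + t * k).
    move=> t; have tk : ( *%R^~ k) x @[x --> t] --> t * k by apply: cvgMr_tmp; exact: cvg_id.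
    exact: (cvgD (cvg_cst c) tk).
  have segC : continuous (on_seg u v) by move=> t; exact: (cvg_pair (aff _ _ t) (aff _ _ t)).
  exact: continuous_subspaceT.
- by move=> s t _ _; exact: on_seg_inj.
- exact: on_seg0.
- exact: on_seg1.
Qed.

Definition same_edge (u v p q : int * int) : Prop :=
  (u = p /\ v = q) \/ (u = q /\ v = p).

(* An interior point of a king move determines that move up to the choice of
   the diagonal of the unit square. *)
Lemma on_seg_interior u v t (z := on_seg u v t) (a := Num.floor z.1) (b := Num.floor z.2) :
  king u v -> 0 < t < 1 ->
  [\/ [/\ a%:~R < z.1, b%:~R = z.2 & same_edge u v (a, b) (a + 1, b)],
      [/\ a%:~R = z.1, b%:~R < z.2 & same_edge u v (a, b) (a, b + 1)] |
      [/\ a%:~R < z.1, b%:~R < z.2 & same_edge u v (a, b) (a + 1, b + 1) \/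
                                     same_edge u v (a + 1, b) (a, b + 1)]].
Proof.
rewrite {}/a {}/b {}/z; case: u v => [a b] [c d] /and3P[neq /= h1 h2] /andP[t0 t1].
have fl (m k : int) :
   let w := m%:~R + t * k%:~R in
   [/\ k = 0 -> Num.floor w = m /\ (Num.floor w)%:~R = w,
       k = 1 -> Num.floor w = m /\ (Num.floor w)%:~R < w &
       k = -1 -> Num.floor w = m - 1 /\ (Num.floor w)%:~R < w].
  move=> w; rewrite /w; split=> ->.
  - by rewrite mulr0 addr0 intrKfloor.
  - have -> : Num.floor (m%:~R + t * 1%:~R) = m.
      by apply: floor_def; rewrite !intrD; lra.
    by split => //; lra.
  - have -> : Num.floor (m%:~R + t * (-1)%:~R) = m - 1.
      by apply: floor_def; rewrite !intrD; lra.
    by split => //; rewrite !intrD; lra.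
have E1 : c - a = 0 \/ c - a = 1 \/ c - a = -1 by lia.
have E2 : d - b = 0 \/ d - b = 1 \/ d - b = -1 by lia.
have [F10 F11 F12] := fl a (c - a); have [F20 F21 F22] := fl b (d - b).
have {fl} nz : ~ (c - a = 0 /\ d - b = 0).
  by move=> [z1 z2]; case/negP: neq; apply/eqP; congr pair; lia.
rewrite /on_seg /=.
case: E1 => [e1|[e1|e1]]; [have [G1 G1'] := F10 e1|have [G1 G1'] := F11 e1|have [G1 G1'] := F12 e1];
(case: E2 => [e2|[e2|e2]]; [have [G2 G2'] := F20 e2|have [G2 G2'] := F21 e2|have [G2 G2'] := F22 e2]).
- by case: nz.
- by apply: Or32; split=> //; left; rewrite G1 G2; split; congr pair; lia.
- by apply: Or32; split=> //; right; rewrite G1 G2; split; congr pair; lia.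
- by apply: Or31; split=> //; left; rewrite G1 G2; split; congr pair; lia.
- by apply: Or33; split=> //; left; left; rewrite G1 G2; split; congr pair; lia.
- by apply: Or33; split=> //; right; right; rewrite G1 G2; split; congr pair; lia.
- by apply: Or31; split=> //; right; rewrite G1 G2; split; congr pair; lia.
- by apply: Or33; split=> //; right; left; rewrite G1 G2; split; congr pair; lia.
- by apply: Or33; split=> //; left; right; rewrite G1 G2; split; congr pair; lia.
Qed.

(** At a lattice point both coordinates equal their floors, whereas each case of [on_seg_interior]
    contains a strict inequality. *)
Lemma on_seg_interiorN u v t w : king u v -> 0 < t < 1 -> on_seg u v t <> emb w.
Proof.
move=> kuv t01 eqw; have := on_seg_interior _ _ _ kuv t01.
rewrite eqw /= !intrKfloor !ltxx.
by case=> -[].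
Qed.

Lemma on_seg_ends u v t : 0 <= t <= 1 ->
  [\/ on_seg u v t = emb u, on_seg u v t = emb v | 0 < t < 1].
Proof.
move=> /andP[]; rewrite !le_eqVlt => /orP[/eqP <-|t0]; first by rewrite on_seg0; constructor 1.
by move=> /orP[/eqP ->|t1]; [rewrite on_seg1; constructor 2 | constructor 3; rewrite t0].
Qed.

(** Each vertex stays at its own place. A common interior point of two edges has one pair of floors,
    so by [on_seg_interior] the edges agree or are the two diagonals of a unit square. *)
Lemma king_planar (G : sgraph (int * int)) :
  (forall p q, adj G p q -> king p q) -> no_crossing (adj G) -> planar R G.
Proof.
move=> kG ncG; exists emb, (fun u v => on_seg u v @` `[0, 1]%classic).
have kneq u v : adj G u v -> u != v by move=> /kG /and3P[].
have swap u v : on_seg u v @` `[0, 1]%classic `<=` on_seg v u @` `[0, 1]%classic.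
  move=> _ /= [t t01 <-]; exists (1 - t); last by rewrite [RHS]on_segC.
  by move: t01; rewrite /= !in_itv /=; lra.
split.
- exact: emb_inj.
- by move=> u v; apply/seteqP; split; exact: swap.
- by move=> u v /kneq uv; exact: on_seg_arc.
- move=> u v w uv [t /=]; rewrite in_itv /= => /(on_seg_ends u v)[-> /emb_inj|-> /emb_inj|t01 /esym].
  + by left.
  + by right.
  + by move/esym/on_seg_interiorN => /(_ (kG _ _ uv) t01).
- move=> u v x y uv xy neq z [[t /=]]; rewrite in_itv /= => /(on_seg_ends u v) ht tz.
  move=> [s /=]; rewrite in_itv /= => /(on_seg_ends x y) hs sz.
  have [kuv kxy] := (kG _ _ uv, kG _ _ xy).
  case: ht => [e1|e1|t01]; case: hs => [e2|e2|s01].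
  + by exists u; [split; [left|left; apply: emb_inj; rewrite -e1 -e2 tz sz] | rewrite -e1 tz].
  + by exists u; [split; [left|right; apply: emb_inj; rewrite -e1 -e2 tz sz] | rewrite -e1 tz].
  + by case: (on_seg_interiorN _ _ _ u kxy s01); rewrite sz -tz e1.
  + by exists v; [split; [right|left; apply: emb_inj; rewrite -e1 -e2 tz sz] | rewrite -e1 tz].
  + by exists v; [split; [right|right; apply: emb_inj; rewrite -e1 -e2 tz sz] | rewrite -e1 tz].
  + by case: (on_seg_interiorN _ _ _ v kxy s01); rewrite sz -tz e1.
  + by case: (on_seg_interiorN _ _ _ x kuv t01); rewrite tz -sz e2.
  + by case: (on_seg_interiorN _ _ _ y kuv t01); rewrite tz -sz e2.
  + exfalso; have := on_seg_interior _ _ _ kuv t01; have := on_seg_interior _ _ _ kxy s01.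
    rewrite tz sz; move: (Num.floor z.1) (Num.floor z.2) => a b I1 I2.
    have nsame p q : same_edge u v p q -> same_edge x y p q -> False.
      by case=> -[eu ev] [] [ex ey]; apply: neq; subst; rewrite // setUC.
    have asym := adj_sym G.
    case: I1 => -[h1 h2 h3]; case: I2 => -[k1 k2 k3];
      try (by clear -h1 h2 k1 k2; lra); try exact: nsame k3 h3.
    (* Both edges are diagonals of the unit square at [(a, b)]; if they differ, they cross. *)
    case: h3 => h3; case: k3 => k3; try exact: nsame k3 h3.
    * by apply: (ncG a b); [case: h3 xy|case: k3 uv] => -[-> ->] //; rewrite asym.
    * by apply: (ncG a b); [case: k3 uv|case: h3 xy] => -[-> ->] //; rewrite asym.
Qed.

End KingPlanar.

(** * The slow graph *)

(** A horizontal grid edge is deleted when x + 2 y is divisible by 5 at its right end, a vertical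
    one when 2 x + y is so at its upper end. This slows down travel near the axis directions, where
    grid paths would be as fast as straight lines. *)
Definition slow (p q : int * int) : bool :=
  [|| [&& p.2 == q.2, q.1 == p.1 + 1 & ((q.1 + 2 * q.2) %% 5)%Z != 0],
      [&& p.2 == q.2, p.1 == q.1 + 1 & ((p.1 + 2 * p.2) %% 5)%Z != 0],
      [&& p.1 == q.1, q.2 == p.2 + 1 & ((q.2 + 2 * q.1) %% 5)%Z != 0] |
      [&& p.1 == q.1, p.2 == q.2 + 1 & ((p.2 + 2 * p.1) %% 5)%Z != 0]].

Definition taxi (p q : int * int) : int := `|p.1 - q.1| + `|p.2 - q.2|.

Lemma slow_sym : symmetric slow.
Proof. by move=> [a b] [c d]; rewrite /slow /=; lia. Qed.

Lemma slow_taxi p q : slow p q -> taxi p q = 1.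
Proof. by case: p q => [a b] [c d]; rewrite /slow /taxi /=; lia. Qed.

Lemma slow_path_potential (F : int * int -> int) p s :
  (forall p q, slow p q -> `|F p - F q| <= 1) ->
  path slow p s -> `|F p - F (last p s)| <= (size s)%:Z.
Proof.
move=> F1; elim: s p => [p|q s IHs p] /=; first by rewrite subrr normr0.
by move=> /andP[/F1 h /IHs h2]; lia.
Qed.

(* Along a slow edge x + (x + 2 y) / 5 changes by at most 1, because the
   horizontal edges where the quotient jumps are missing. *)
Lemma slow_path_drift p q s : path slow p s -> last p s = q ->
  `|6 * (p.1 - q.1) + 2 * (p.2 - q.2)| <= 5 * (size s)%:Z + 4.
Proof.
move=> ps lq; pose F (r : int * int) := r.1 + ((r.1 + 2 * r.2) %/ 5)%Z.
have step p' q' : slow p' q' -> `|F p' - F q'| <= 1.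
  by case: p' q' => [a b] [c d]; rewrite /slow /F /=; lia.
have := slow_path_potential _ _ _ step ps; rewrite lq /F.
by move: q {lq} => [c d]; case: p {ps step F} => a b /=; lia.
Qed.

Lemma slow_path_drift' p q s : path slow p s -> last p s = q ->
  `|6 * (p.2 - q.2) + 2 * (p.1 - q.1)| <= 5 * (size s)%:Z + 4.
Proof.
move=> ps lq; pose F (r : int * int) := r.2 + ((r.2 + 2 * r.1) %/ 5)%Z.
have step p' q' : slow p' q' -> `|F p' - F q'| <= 1.
  by case: p' q' => [a b] [c d]; rewrite /slow /F /=; lia.
have := slow_path_potential _ _ _ step ps; rewrite lq /F.
by move: q {lq} => [c d]; case: p {ps step F} => a b /=; lia.
Qed.

Lemma slow_path_taxi p s : path slow p s -> taxi p (last p s) <= (size s)%:Z.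
Proof.
elim: s p => [p|q s IHs p] /=; first by rewrite /taxi; lia.
by move=> /andP[/slow_taxi h /IHs]; move: (last q s) h => r; rewrite /taxi; lia.
Qed.

(** A deleted edge is bypassed along the other three sides of one of the two unit squares containing
    it; the residues modulo 5 never spoil both squares. *)
Lemma slow_detour p q : taxi p q = 1 -> exists s, [/\ path slow p s, last p s = q & (size s <= 3)%N].
Proof.
have horiz x y : exists s, [/\ path slow (x, y) s, last (x, y) s = (x + 1, y) & (size s <= 3)%N].
  have [h|h] := boolP (slow (x, y) (x + 1, y)); first by exists [:: (x + 1, y)]; rewrite /= h.
  have [h1|h1] := boolP (slow (x, y) (x, y + 1) && slow (x + 1, y + 1) (x + 1, y)).
    exists [:: (x, y + 1); (x + 1, y + 1); (x + 1, y)]; split=> //=.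
    by move: h h1; rewrite /slow /=; lia.
  exists [:: (x, y - 1); (x + 1, y - 1); (x + 1, y)]; split=> //=.
  by move: h h1; rewrite /slow /=; lia.
have vert x y : exists s, [/\ path slow (x, y) s, last (x, y) s = (x, y + 1) & (size s <= 3)%N].
  have [h|h] := boolP (slow (x, y) (x, y + 1)); first by exists [:: (x, y + 1)]; rewrite /= h.
  have [h1|h1] := boolP (slow (x, y) (x + 1, y) && slow (x + 1, y + 1) (x, y + 1)).
    exists [:: (x + 1, y); (x + 1, y + 1); (x, y + 1)]; split=> //=.
    by move: h h1; rewrite /slow /=; lia.
  exists [:: (x - 1, y); (x - 1, y + 1); (x, y + 1)]; split=> //=.
  by move: h h1; rewrite /slow /=; lia.
have rv p' q' : (exists s, [/\ path slow p' s, last p' s = q' & (size s <= 3)%N]) ->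
    exists s, [/\ path slow q' s, last q' s = p' & (size s <= 3)%N].
  move=> [s [ps ls ss]]; exists (rev (belast p' s)); rewrite size_rev size_belast; split=> //.
    by rewrite -ls rev_path; apply: sub_path ps => a b /=; rewrite slow_sym.
  by case: s {ps ss} ls => [//|a s] _ /=; rewrite rev_cons last_rcons.
case: p q => [a b] [c d]; rewrite /taxi /= => h.
have [[-> ->]|[[-> ->]|[[-> ->]|[-> ->]]]] :
  (c = a + 1 /\ d = b) \/ (c = a - 1 /\ d = b) \/ (c = a /\ d = b + 1) \/ (c = a /\ d = b - 1) by lia.
- exact: horiz.
- by have := horiz (a - 1) b; rewrite subrK => /rv.
- exact: vert.
- by have := vert a (b - 1); rewrite subrK => /rv.
Qed.

Lemma slow_reach (R : realType) (p q : int * int) :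
  reach (R := R) slow (3 * (taxi p q)%:~R) p q.
Proof.
have [n] := ubnP (absz (taxi p q)); elim: n p => // n IHn p hn.
have [pq0|pq0] := eqVneq (taxi p q) 0.
  have -> : p = q.
    by case: p q pq0 {hn IHn} => [a b] [c d]; rewrite /taxi /= => h; congr pair; lia.
  by apply: reach_refl; rewrite mulr_ge0 // ler0z /taxi; lia.
have [r [pr rq]] : exists r, taxi p r = 1 /\ taxi p q = taxi r q + 1.
  case: p q pq0 {hn IHn} => [a b] [c d]; rewrite /taxi /= => h.
  have [ac|[ac|ac]] : a < c \/ c < a \/ a = c by lia.
  - by exists (a + 1, b) => /=; lia.
  - by exists (a - 1, b) => /=; lia.
  have [bd|bd] : b < d \/ d < b by lia.
  - by exists (a, b + 1) => /=; lia.
  - by exists (a, b - 1) => /=; lia.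
rewrite rq intrD mulrDr addrC.
have [s [ps ls ss]] := slow_detour _ _ pr.
apply: (reach_trans _ _ _ r); last by apply: IHn; move: hn rq; rewrite /taxi; lia.
by exists s; split=> //; rewrite mulr1 ler_nat.
Qed.

(** * Roads *)

Section EuclideanPlane.
Context {R : realType}.
Implicit Types (a b c d : R) (x y z : R * R).

Definition norm2 x : R := Num.sqrt (x.1 ^+ 2 + x.2 ^+ 2).

Lemma norm2_ge0 x : 0 <= norm2 x.
Proof. exact: sqrtr_ge0. Qed.

Lemma sqr_norm2 x : norm2 x ^+ 2 = x.1 ^+ 2 + x.2 ^+ 2.
Proof. by rewrite sqr_sqrtr // addr_ge0 ?sqr_ge0. Qed.

Lemma norm2_le x c : 0 <= c -> x.1 ^+ 2 + x.2 ^+ 2 <= c ^+ 2 -> norm2 x <= c.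
Proof. by move=> c0 h; rewrite -(ler_pXn2r (n := 2)) ?nnegrE ?norm2_ge0 // sqr_norm2. Qed.

Lemma norm2_ge x c : c ^+ 2 <= x.1 ^+ 2 + x.2 ^+ 2 -> c <= norm2 x.
Proof.
move=> h; have [c0|c0] := ltP c 0; first by rewrite (le_trans (ltW c0)) ?norm2_ge0.
by rewrite -(ler_pXn2r (n := 2)) ?nnegrE ?norm2_ge0 // sqr_norm2.
Qed.

Lemma ler_norm2D x y : norm2 (x + y) <= norm2 x + norm2 y.
Proof.
apply: norm2_le; first by rewrite addr_ge0 ?norm2_ge0.
have dot : x.1 * y.1 + x.2 * y.2 <= norm2 x * norm2 y.
  have [h|h] := ltP (x.1 * y.1 + x.2 * y.2) 0.
    by rewrite (le_trans (ltW h)) // mulr_ge0 ?norm2_ge0.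
  rewrite -(ler_pXn2r (n := 2)) ?nnegrE ?mulr_ge0 ?norm2_ge0 //.
  rewrite exprMn !sqr_norm2 -subr_ge0.
  have -> : (x.1 ^+ 2 + x.2 ^+ 2) * (y.1 ^+ 2 + y.2 ^+ 2) - (x.1 * y.1 + x.2 * y.2) ^+ 2 =
    (x.1 * y.2 - x.2 * y.1) ^+ 2 by ring.
  exact: sqr_ge0.
have := sqr_norm2 x; have := sqr_norm2 y.
by rewrite sqrrD /=; lra.
Qed.

Lemma norm2N x : norm2 (- x) = norm2 x.
Proof. by rewrite /norm2 /= !sqrrN. Qed.

Lemma ler_dist2 x y z : norm2 (x - z) <= norm2 (x - y) + norm2 (y - z).
Proof. by rewrite -{1}(subrK y x) -addrA ler_norm2D. Qed.

Lemma dist2C x y : norm2 (x - y) = norm2 (y - x).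
Proof. by rewrite -norm2N opprB. Qed.

Lemma norm2_le_taxi x : norm2 x <= `|x.1| + `|x.2|.
Proof.
apply: norm2_le; first by rewrite addr_ge0.
by have := normr_ge0 x.1; have := normr_ge0 x.2; rewrite -(real_normK (num_real x.1)) -(real_normK (num_real x.2)); nra.
Qed.

Lemma taxi_le_norm2 x : `|x.1| + `|x.2| <= 2 * norm2 x.
Proof.
have n0 := norm2_ge0 x; rewrite -(ler_pXn2r (n := 2)) ?nnegrE ?addr_ge0 ?mulr_ge0 //.
rewrite exprMn sqr_norm2 -(real_normK (num_real x.1)) -(real_normK (num_real x.2)).
by have := sqr_ge0 (`|x.1| - `|x.2|); nra.
Qed.

Lemma norm2_near x : `|x.1| < 2 -> `|x.2| < 2 -> norm2 x <= 3.
Proof.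
move=> h1 h2; apply: norm2_le => //.
rewrite -(real_normK (num_real x.1)) -(real_normK (num_real x.2)).
by have := normr_ge0 x.1; have := normr_ge0 x.2; nra.
Qed.

Lemma eucl_distE (p q : int * int) : eucl_dist R p q = norm2 (emb p - emb q).
Proof. by rewrite /eucl_dist /norm2 /= !intrB. Qed.

Lemma taxi_emb (p q : int * int) :
  (taxi p q)%:~R = `|(emb p - emb q).1| + `|(emb p - emb q).2| :> R.
Proof. by rewrite /taxi intrD !intr_norm !intrB. Qed.

Lemma norm2_le_taxi_emb (p q : int * int) : norm2 (emb p - emb q) <= (taxi p q)%:~R :> R.
Proof. by rewrite taxi_emb norm2_le_taxi. Qed.

(** Ten times the taxicab bound added to a drift bound gives 16 |dx| + 8 |dy| <= 15 k + 4, and its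
    mirror image. The one with the larger coordinate in front dominates 16 times the norm. *)
Lemma slow_path_norm2 p q s : path slow p s -> last p s = q ->
  16 * norm2 (emb p - emb q : R * R) <= 15 * (size s)%:R + 4.
Proof.
move=> ps lq; rewrite -ler_pdivlMl //.
have h1 := slow_path_drift _ _ _ ps lq; have h2 := slow_path_drift' _ _ _ ps lq.
have := slow_path_taxi _ _ ps; rewrite lq /taxi => h3.
have [h4 h5] : 16 * `|p.1 - q.1| + 8 * `|p.2 - q.2| <= 15 * (size s)%:Z + 4 /\
               8 * `|p.1 - q.1| + 16 * `|p.2 - q.2| <= 15 * (size s)%:Z + 4 by split; lia.
move: h4 h5; rewrite -(ler_int R) -(ler_int R (8 * _ + _)) !intrD !intrM !intr_norm !intrB /= -!pmulrn.
set a : R := p.1%:~R - _; set b : R := p.2%:~R - _; set k : R := (size s)%:R => h4 h5.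
have k0 : 0 <= k by [].
apply: norm2_le => /=; first by rewrite mulr_ge0 //; lra.
rewrite -(real_normK (num_real a)) -(real_normK (num_real b)).
have := normr_ge0 a; have := normr_ge0 b.
move: (`|a|) (`|b|) h4 h5 => A B h4 h5 B0 A0.
have : 256 * (A ^+ 2 + B ^+ 2) <= (15 * k + 4) ^+ 2.
  by have [AB|BA] := leP A B; nra.
by rewrite exprMn; lra.
Qed.

End EuclideanPlane.

Section Road.
Context {R : realType} (p u : R * R).

Definition ideal (i : int) : R * R := (p.1 + i%:~R * u.1, p.2 + i%:~R * u.2).

Let across (i : int) : int := Num.floor (i%:~R * `|u.1|).
(** Of i steps about i |u1| are horizontal and i |u2| vertical, so about i (|u1| + |u2| - 1) are
    both; the quotient is their share among the horizontal steps. *)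
Let both (i : int) : int := Num.floor ((across i)%:~R * ((`|u.1| + `|u.2| - 1) / `|u.1|)).

(* Every step moves horizontally or vertically; the steps doing both are
   spread evenly among the horizontal ones, so that n steps have length n. *)
Definition road (i : int) : int * int :=
  (Num.floor p.1 + sgz u.1 * across i,
   Num.floor p.2 + sgz u.2 * (i - across i + both i)).

Hypothesis u_unit : u.1 ^+ 2 + u.2 ^+ 2 = 1.
Hypotheses (u1_neq0 : u.1 != 0) (u2_neq0 : u.2 != 0).

Lemma floor_step (c : R) (i : R) : 0 <= c <= 1 ->
  Num.floor (i + c) = Num.floor i \/ Num.floor (i + c) = Num.floor i + 1.
Proof.
move=> c01; have := floor_itv i; have := floor_itv (i + c).
move: (Num.floor _) (Num.floor _) => b a; rewrite !intrD => h1 h2.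
have h3 : b < a + 1 by rewrite -(ltr_int R) intrD; lra.
have h4 : a < b + 2 by rewrite -(ltr_int R) intrD; lra.
lia.
Qed.

Let r : R := (`|u.1| + `|u.2| - 1) / `|u.1|.

Lemma road_facts : [/\ 0 < `|u.1| <= 1, 0 < `|u.2| <= 1 & 1 <= `|u.1| + `|u.2|].
Proof.
have a0 : 0 < `|u.1| by rewrite normr_gt0.
have b0 : 0 < `|u.2| by rewrite normr_gt0.
move: u_unit; rewrite -(real_normK (num_real u.1)) -(real_normK (num_real u.2)) => h.
by split; rewrite ?a0 ?b0 /=; nra.
Qed.

Lemma road_rate : 0 <= r <= 1.
Proof.
have [/andP[a0 a1] /andP[b0 b1] ab] := road_facts.
by rewrite /r divr_ge0 ?(ltW a0) ?subr_ge0 //= ler_pdivrMr // mul1r; lra.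
Qed.

Lemma across_step i : across (i + 1) = across i \/ across (i + 1) = across i + 1.
Proof.
have [/andP[a0 a1] _ _] := road_facts.
by rewrite /across intrD mulrDl mul1r; apply: floor_step; rewrite ltW.
Qed.

Lemma road_step i : exists d1 d2 : int,
  [/\ d1 = 0 \/ d1 = 1, d2 = 0 \/ d2 = 1, (d1, d2) <> (0, 0) &
      road (i + 1) = ((road i).1 + sgz u.1 * d1, (road i).2 + sgz u.2 * d2)].
Proof.
have := road_rate; rewrite /road /both -/r => r01; case: (across_step i) => ->.
  exists 0, 1; split; [by left|by right|by []|]; congr pair => /=; ring.
rewrite intrD mulrDl mul1r; case: (floor_step r ((across i)%:~R * r) r01) => ->.
  exists 1, 0; split; [by right|by left|by []|]; congr pair => /=; ring.
exists 1, 1; split; [by right|by right|by []|]; congr pair => /=; ring.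
Qed.

Lemma sgz_neq0 (c : R) : c != 0 -> sgz c = 1 \/ sgz c = -1.
Proof. by rewrite /sgz; case: ifP => // _ _; case: ifP; [right|left]. Qed.

Lemma road_king i : king (road i) (road (i + 1)).
Proof.
have [d1 [d2 [h1 h2 h3 ->]]] := road_step i.
have d0 : d1 <> 0 \/ d2 <> 0.
  by have [d10|/eqP] := eqVneq d1 0; [right=> d20; apply: h3; rewrite d10 d20|left].
rewrite /king; have -> : road i = ((road i).1, (road i).2) by case: (road i).
rewrite xpair_eqE /=.
case: (sgz_neq0 _ u1_neq0) => ->; case: (sgz_neq0 _ u2_neq0) => ->; lia.
Qed.

(** All steps go into the same quadrant, so their taxicab lengths, 1 or 2 each, add up without
    cancellation. *)
Lemma road_monotone i j : i <= j ->
  j - i <= taxi (road i) (road j) <= 2 * (j - i).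
Proof.
move=> ij; have [n ->] : exists n : nat, j = i + n%:Z by exists (absz (j - i)); lia.
have : exists a b : int, [/\ 0 <= a <= n%:Z, 0 <= b <= n%:Z, n%:Z <= a + b &
    road (i + n%:Z) = ((road i).1 + sgz u.1 * a, (road i).2 + sgz u.2 * b)].
  elim: n => [|n [a [b [a0 b0 ab e]]]].
    by exists 0, 0; rewrite !mulr0 !addr0; split => //; case: (road i).
  have [d1 [d2 [h1 h2 h3]]] := road_step (i + n%:Z).
  have d0 : d1 <> 0 \/ d2 <> 0.
    by have [d10|/eqP] := eqVneq d1 0; [right=> d20; apply: h3; rewrite d10 d20|left].
  rewrite e /= => e'; exists (a + d1), (b + d2); split; try lia.
  rewrite -[n.+1]addn1 PoszD addrA e'; congr pair; ring.
move=> [a [b [a0 b0 ab ->]]]; rewrite /taxi /=.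
case: (sgz_neq0 _ u1_neq0) => ->; case: (sgz_neq0 _ u2_neq0) => ->; lia.
Qed.

Lemma road_taxi i j : `|i - j| <= taxi (road i) (road j) <= 2 * `|i - j|.
Proof.
have [ij|ji] := leP i j; first by have := road_monotone _ _ ij; lia.
have tC : taxi (road i) (road j) = taxi (road j) (road i) by rewrite /taxi; lia.
by rewrite tC; have := road_monotone _ _ (ltW ji); lia.
Qed.

(** Rounding the base point costs less than 1 in each coordinate, and rounding the step counts less
    than 1 again. *)
Lemma road_near i : `|(emb (road i) - ideal i).1| < 2 /\ `|(emb (road i) - ideal i).2| < 2.
Proof.
have [/andP[a0 a1] /andP[b0 b1] ab] := road_facts.
have /andP[r0 r1] := road_rate.
have near (c v : R) (m : int) : v != 0 -> `|m%:~R - c * `|v| | < 1 -> forall q : R,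
    `|(Num.floor q + sgz v * m)%:~R - (q + c * v)| < 2.
  move=> v0 h q; have := floor_itv q; rewrite !intrD intrM => hq.
  have [e|e] := sgz_neq0 _ v0.
    have vE : `|v| = v by rewrite gtr0_norm // -sgz_gt0 e.
    by move: h; rewrite e vE !ltr_norml; lra.
  have vE : `|v| = - v by rewrite ltr0_norm // -sgz_lt0 e.
  by move: h; rewrite e vE !ltr_norml; lra.
have hx := floor_itv (i%:~R * `|u.1|); have hy := floor_itv ((across i)%:~R * r).
move: hx hy; rewrite -/(across i) -/(both i) !intrD => hx hy.
split; apply: near => //; rewrite ltr_norml; first by lra.
have e : r * `|u.1| = `|u.1| + `|u.2| - 1 by rewrite /r divfK // gt_eqF.
rewrite !intrD !intrN.
move: hx hy e; move: (across i)%:~R (both i)%:~R i%:~R => A B I hx hy e.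
(* with A = I |u1| - d, 0 <= d < 1, one gets I - A + r A = I |u2| + d (1 - r) *)
have -> : I * `|u.2| = I - A + r * A - (I * `|u.1| - A) * (1 - r).
  rewrite (_ : (I * `|u.1| - A) * (1 - r) = I * (`|u.1| - r * `|u.1|) - A + r * A); last by ring.
  by rewrite e; ring.
nra.
Qed.

Lemma road_near_norm2 i : norm2 (emb (road i) - ideal i) <= 3.
Proof. by have [h1 h2] := road_near i; exact: norm2_near. Qed.

Lemma ideal_dist i j : norm2 (ideal i - ideal j) = `|i - j|%:~R.
Proof.
rewrite /norm2 /ideal /=.
have -> : (p.1 + i%:~R * u.1 - (p.1 + j%:~R * u.1)) ^+ 2 +
  (p.2 + i%:~R * u.2 - (p.2 + j%:~R * u.2)) ^+ 2 = (i - j)%:~R ^+ 2 * (u.1 ^+ 2 + u.2 ^+ 2).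
  by rewrite intrB; ring.
by rewrite u_unit mulr1 sqrtr_sqr intr_norm.
Qed.

End Road.

(** * Networks of separated roads *)

Section RoadNetwork.
Context {R : realType} {T : Type} (built : T -> Prop) (base dir : T -> R * R)
  (span : T -> int -> Prop).

Definition road_edge (x y : int * int) : Prop :=
  exists c i, [/\ built c, span c i, span c (i + 1) &
    (x = road (base c) (dir c) i /\ y = road (base c) (dir c) (i + 1)) \/
    (y = road (base c) (dir c) i /\ x = road (base c) (dir c) (i + 1))].

Definition network (x y : int * int) : bool := slow x y || `[< road_edge x y >].

Hypothesis dir_unit : forall c, built c -> (dir c).1 ^+ 2 + (dir c).2 ^+ 2 = 1.
Hypotheses (dir1 : forall c, built c -> (dir c).1 != 0)
           (dir2 : forall c, built c -> (dir c).2 != 0).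
Hypothesis separated : forall c d i j, built c -> built d -> span c i -> span d j -> c <> d ->
  110 <= norm2 (ideal (base c) (dir c) i - ideal (base d) (dir d) j).

Let rho c := road (base c) (dir c).
Let phi c := ideal (base c) (dir c).

Lemma network_sym : symmetric network.
Proof.
move=> x y; rewrite /network slow_sym; congr (_ || _).
by apply/asboolP/asboolP => -[c [i [h1 h2 h3 [h|h]]]]; exists c, i; split=> //; [right|left|right|left].
Qed.

Lemma slow_king x y : slow x y -> king x y.
Proof. by case: x y => [a b] [c d]; rewrite /slow /king xpair_eqE /=; lia. Qed.

Lemma network_king x y : network x y -> king x y.
Proof.
move=> /orP[/slow_king //|/asboolP[c [i [bc _ _ h]]]].
have := road_king (base c) (dir c) (dir_unit _ bc) (dir1 _ bc) (dir2 _ bc) i.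
by case: h => -[-> ->] //; rewrite /king eq_sym !(distrC (road _ _ i).1) !(distrC (road _ _ i).2).
Qed.

Lemma rho_near c i : built c -> norm2 (emb (rho c i) - phi c i) <= 3.
Proof. by move=> bc; apply: road_near_norm2; [exact: dir_unit|exact: dir1|exact: dir2]. Qed.

Lemma near_chords_eq c d i j : built c -> built d -> span c i -> span d j ->
  taxi (rho c i) (rho d j) <= 2 -> c = d.
Proof.
move=> bc bd sc sd h; apply: contrapT => cd; have := separated _ _ _ _ bc bd sc sd cd.
rewrite -/(phi c) -/(phi d).
have := ler_dist2 (phi c i) (emb (rho c i)) (phi d j).
have := ler_dist2 (emb (rho c i)) (emb (rho d j)) (phi d j).
rewrite (dist2C (phi c i) (emb _)).
have := rho_near _ i bc; have := rho_near _ j bd.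
have := norm2_le_taxi_emb (rho c i) (rho d j) (R := R).
have : (taxi (rho c i) (rho d j))%:~R <= 2%:~R :> R by rewrite ler_int.
by lra.
Qed.

(* A road only uses diagonals of one slope, and two roads are too far apart to cross. *)
Lemma network_no_crossing : no_crossing network.
Proof.
move=> x y.
have diag p q : network p q -> taxi p q = 2 -> exists c i,
    [/\ built c, span c i, (p = rho c i \/ q = rho c i) &
      (p.1 - q.1) * (p.2 - q.2) = sgz (dir c).1 * sgz (dir c).2].
  move=> /orP[/slow_taxi -> //|/asboolP[c [i [bc sc _ h]]] t2]; exists c, i.
  have [d1 [d2 [e1 e2 _ e]]] := road_step (base c) (dir c) (dir_unit _ bc) (dir1 _ bc) (dir2 _ bc) i.
  split=> //; first by case: h => -[-> ->]; [left|right].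
  have s1 := sgz_neq0 _ (dir1 _ bc); have s2 := sgz_neq0 _ (dir2 _ bc).
  move: t2; rewrite /taxi; case: h => -[-> ->]; rewrite e /=;
    case: s1 => ->; case: s2 => ->; case: e1 => ->; case: e2 => -> /=; lia.
move=> /diag h /diag k.
have h2 : taxi (x, y) (x + 1, y + 1) = 2 by rewrite /taxi /=; lia.
have k2 : taxi (x + 1, y) (x, y + 1) = 2 by rewrite /taxi /=; lia.
have [c [i [bc sc pc ec]]] := h h2; have [d [j [bd sd pd ed]]] := k k2.
have cd : c = d.
  apply: near_chords_eq sc sd _ => //.
  by case: pc => <-; case: pd => <-; rewrite /taxi /=; lia.
by move: ec ed; rewrite cd /= => <-; lia.
Qed.

(** Leaving a road for the slow graph never pays. On one road this is the taxicab comparison.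
    Between two roads at ideal distance D, rounding costs 6 and 16 (D - 6) <= 15 k + 4, whence D <=
    k as soon as D >= 100; the separation 110 guarantees this. *)
Lemma network_slow_road c d i j s : built c -> built d -> span c i -> span d j ->
  path slow (rho c i) s -> last (rho c i) s = rho d j ->
  norm2 (phi c i - phi d j) <= (size s)%:R.
Proof.
move=> bc bd sc sd ps ls.
have [cd|cd] := pselect (c = d).
  subst d; rewrite (ideal_dist _ _ (dir_unit _ bc)).
  have := road_taxi (base c) (dir c) (dir_unit _ bc) (dir1 _ bc) (dir2 _ bc) i j.
  have := slow_path_taxi _ _ ps; rewrite ls => h1 /andP[h2 _].
  by rewrite pmulrn ler_int; exact: le_trans h1.
have := separated _ _ _ _ bc bd sc sd cd; rewrite -/(phi c) -/(phi d).
have := ler_dist2 (phi c i) (emb (rho c i)) (phi d j).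
have := ler_dist2 (emb (rho c i)) (emb (rho d j)) (phi d j).
rewrite (dist2C (phi c i) (emb _)).
have := rho_near _ i bc; have := rho_near _ j bd.
by have := slow_path_norm2 (R := R) _ _ _ ps ls; lra.
Qed.

(** Only the last road vertex visited and the slow path since then are remembered. A slow step
    lengthens that path; a road step restarts it, after the pending slow path has been exchanged for
    a distance between ideal points. *)
Lemma network_path_invariant p s : path network p s ->
  (exists t, [/\ path slow p t, last p t = last p s & (size t <= size s)%N]) \/
  (exists c i t, [/\ built c, span c i, path slow (rho c i) t, last (rho c i) t = last p s &
     norm2 (phi c i - emb p) + (size t)%:R <= (size s)%:R + 3]).
Proof.
elim/last_ind: s => [_|s y IHs]; first by left; exists [::].
rewrite rcons_path last_rcons size_rcons => /andP[/IHs{}IHs].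
move: (last p s) IHs => x IHs /orP[xy|/asboolP[d [j [bd sd sd1 h]]]].
  case: IHs => [[t [pt lt st]]|[c [i [t [bc sc pt lt nt]]]]]; [left|right].
    by exists (rcons t y); rewrite rcons_path last_rcons size_rcons pt lt.
  exists c, i, (rcons t y); rewrite rcons_path last_rcons size_rcons pt lt; split=> //.
  by rewrite -!natr1 addrA; lra.
have [k [l [sk sl xk yl kl]]] : exists k l,
    [/\ span d k, span d l, x = rho d k, y = rho d l & `|k - l| = 1].
  case: h => -[ex ey]; [exists j, (j + 1)|exists (j + 1), j]; split => //; lia.
right; exists d, l, [::]; split=> //=; rewrite addr0 -natr1.
have := ler_dist2 (phi d l) (phi d k) (emb p).
rewrite (ideal_dist _ _ (dir_unit _ bd)) distrC kl mulr1z.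
suff : norm2 (phi d k - emb p) <= (size s)%:R + 3 by lra.
case: IHs => [[t [pt lt st]]|[c [i [t [bc sc pt lt nt]]]]].
  (* The first road is reached here: the offset 3 is the distance from its vertex to the ideal
     point. *)
  have := ler_dist2 (phi d k) (emb (rho d k)) (emb p); rewrite (dist2C (phi d k) (emb (rho d k))).
  have := rho_near _ k bd; have := norm2_le_taxi_emb p (rho d k) (R := R).
  have := slow_path_taxi _ _ pt; rewrite lt xk -(ler_int R) -pmulrn.
  have : (size t)%:R <= (size s)%:R :> R by rewrite ler_nat.
  by rewrite (dist2C (emb p) (emb _)); lra.
(* The slow path from road [c] to road [d] has at least as many steps as the ideal distance. *)
have := ler_dist2 (phi d k) (phi c i) (emb p).
have := network_slow_road _ _ _ _ _ bc bd sc sk pt (etrans lt xk).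
by rewrite (dist2C (phi c i) (phi d k)); lra.
Qed.

(** The loss 6 is the 3 of the invariant plus 3 for returning from the ideal point to the road
    vertex. *)
Lemma network_path_norm2 p s : path network p s ->
  norm2 (emb p - emb (last p s)) - 6 <= (size s)%:R :> R.
Proof.
move=> /network_path_invariant[[t [pt lt st]]|[c [i [t [bc sc pt lt nt]]]]].
  have := norm2_le_taxi_emb p (last p s) (R := R).
  have := slow_path_taxi _ _ pt; rewrite lt -(ler_int R) -pmulrn.
  have : (size t)%:R <= (size s)%:R :> R by rewrite ler_nat.
  by lra.
have := slow_path_taxi _ _ pt; rewrite lt -(ler_int R) -pmulrn => h.
have := norm2_le_taxi_emb (rho c i) (last p s) (R := R).
have := ler_dist2 (emb p) (phi c i) (emb (last p s)).
have := ler_dist2 (phi c i) (emb (rho c i)) (emb (last p s)).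
have := rho_near _ i bc.
by rewrite (dist2C (phi c i) (emb (rho _ _))) (dist2C (emb p) (phi c i)); lra.
Qed.

Lemma network_reach_taxi p q : reach (R := R) network (3 * (taxi p q)%:~R) p q.
Proof.
have [s [ps ls ss]] := slow_reach R p q; exists s; split=> //.
by apply: sub_path ps => x y h; rewrite /network h.
Qed.

Lemma network_reach_road c i (n : nat) : built c ->
  (forall k : nat, (k <= n)%N -> span c (i + k%:Z)) ->
  reach (R := R) network n%:R (rho c i) (rho c (i + n%:Z)).
Proof.
move=> bc; elim: n => [_|n IHn hk]; first by rewrite addr0; exact: reach_refl.
rewrite -natr1; apply: (reach_trans _ _ _ (rho c (i + n%:Z))).
  by apply: IHn => k kn; apply: hk; rewrite ltnW.
apply: reach_adj; apply/orP; right; apply/asboolP; exists c, (i + n%:Z); split=> //.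
- by apply: hk.
- by rewrite -addrA; have := hk n.+1 (leqnn _); rewrite -addn1 PoszD.
- by left; rewrite -[n.+1]addn1 PoszD addrA.
Qed.

End RoadNetwork.

(** * Chords of all levels *)

(** Greedy selection by well-founded recursion: the result is the kernel of the conflict relation
    directed along [lt]. *)
Lemma wf_kernel (T : Type) (lt : T -> T -> Prop) (V : T -> Prop) (conflict : T -> T -> Prop) :
  well_founded lt -> exists A : T -> Prop,
    forall c, A c <-> V c /\ forall d, lt d c -> A d -> ~ conflict c d.
Proof.
move=> wf.
pose F (c : T) (rec : forall d, lt d c -> Prop) : Prop :=
  V c /\ forall d (dc : lt d c), rec d dc -> ~ conflict c d.
exists (Fix wf (fun=> Prop) F) => c; rewrite Fix_eq // => x f g fg.
suff -> : f = g by [].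
by apply: functional_extensionality_dep => d; apply: functional_extensionality_dep => ?.
Qed.

(** A line is given by its level, its heading and its number among the parallels; a chord is a line
    together with one of the squares of its level. *)
Definition line_id : Type := (nat * (bool * int)) * int.
Definition chord_id : Type := line_id * (int * int).

HB.instance Definition _ := Countable.on line_id.
HB.instance Definition _ := Countable.on chord_id.

Definition level (c : chord_id) : nat := c.1.1.1.

(* The directions of level i are (2^i, b) and (b, 2^i) with b odd: by parity, no
   two of them, of whatever levels, are parallel. *)
Definition heading (i : nat) (g : bool * int) : int * int :=
  if g.1 then (g.2, (2 ^ i)%N%:Z) else ((2 ^ i)%N%:Z, g.2).

(** Level 0 is excluded because 2^0 is odd. The bound leaves room for the two odd numbers around any
    slope between -2^i and 2^i. *)
Definition is_heading (i : nat) (g : bool * int) : bool :=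
  [&& (0 < i)%N, odd (absz g.2) & ((absz g.2) <= 3 * 2 ^ i)%N].

(** Higher levels come first, so the cap [J] is what makes the order well founded. *)
Definition preferred (J : nat) (d c : chord_id) : Prop :=
  (level d <= J)%N /\
  ((level c < level d)%N \/ level c = level d /\ (pickle d < pickle c)%N).

Lemma lexicographic_wf (T : Type) (lt : T -> T -> Prop) (f g : T -> nat) :
  (forall d c, lt d c -> (f d < f c)%N \/ f d = f c /\ (g d < g c)%N) -> well_founded lt.
Proof.
move=> ltP; suff H n m c : (f c < n)%N -> (g c < m)%N -> Acc lt c.
  by move=> c; exact: H (ltnSn _) (ltnSn _).
elim: n m c => [m c|n IHn m]; first by rewrite ltn0; discriminate.
elim: m => [c _|m IHm c cn cm]; first by rewrite ltn0; discriminate.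
constructor=> d /ltP [cd|[cd pd]]; last by apply: IHm; lia.
by apply: (IHn (g d).+1); lia.
Qed.

Lemma preferred_wf J : well_founded (preferred J).
Proof.
apply: (lexicographic_wf _ _ (fun c => J - level c)%N pickle) => d c [dJ].
by move: (pickle d) (pickle c) => m n; lia.
Qed.

Lemma preferred_total J c d : (level c <= J)%N -> (level d <= J)%N -> c <> d ->
  preferred J c d \/ preferred J d c.
Proof.
move=> cJ dJ cd; have : pickle c <> pickle d by move=> /(pcan_inj pickleK).
by rewrite /preferred; move: (pickle c) (pickle d) => m n; lia.
Qed.

Section Levels.
Context {R : realType}.
Implicit Types (x y : R * R) (l : line_id) (c d : chord_id).

Definition cross (v x : R * R) : R := v.1 * x.2 - v.2 * x.1.

(** This is measured in values of [cross v]; since v has length about 2^i, parallel lines are about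
    2^(7 i) apart. *)
Definition spacing (i : nat) : R := 2 ^+ (8 * i).
Definition side (i : nat) : R := 4 ^+ i.

Definition line_vec l : R * R := emb (heading l.1.1 l.1.2).
(** The foot of the perpendicular from the origin to the line on which [cross v] equals [l.2] times
    the spacing. *)
Definition line_base l : R * R :=
  let v := line_vec l in let s := l.2%:~R * spacing l.1.1 / (v.1 ^+ 2 + v.2 ^+ 2) in
  (- v.2 * s, v.1 * s).
Definition line_dir l : R * R :=
  let v := line_vec l in (v.1 / norm2 v, v.2 / norm2 v).

Definition on_line l (t : int) : R * R := ideal (line_base l) (line_dir l) t.

Definition pixel (i : nat) x : int * int :=
  (Num.floor (x.1 / side i), Num.floor (x.2 / side i)).

(** The margin 110 is the separation that [network_slow_road] asks for, so chords in different
    squares of one level are automatically far apart. *)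
Definition inner (i : nat) (q : int * int) x : Prop :=
  [/\ q.1%:~R * side i + 110 <= x.1, x.1 <= (q.1 + 1)%:~R * side i - 110,
      q.2%:~R * side i + 110 <= x.2 & x.2 <= (q.2 + 1)%:~R * side i - 110].

Definition chord_span c (t : int) : Prop := inner (level c) c.2 (on_line c.1 t).

(** The whole square of [c], not only its chord, has to be free of [d]; this yields both
    [built_separated] and [built_unique]. *)
Definition obstructs c d : Prop :=
  exists2 t, chord_span d t & pixel (level c) (on_line d.1 t) = c.2.

Definition valid (J : nat) c : Prop := (level c <= J)%N /\ is_heading c.1.1.1 c.1.1.2.

Lemma side_gt0 i : 0 < side i.
Proof. exact: exprn_gt0. Qed.

Lemma pixelP i x q : pixel i x = q <->
  [/\ q.1%:~R * side i <= x.1, x.1 < (q.1 + 1)%:~R * side i,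
      q.2%:~R * side i <= x.2 & x.2 < (q.2 + 1)%:~R * side i].
Proof.
have s0 := side_gt0 i; split.
  move=> <- /=; have := floor_itv (x.1 / side i); have := floor_itv (x.2 / side i).
  by rewrite !ler_pdivlMr // !ltr_pdivrMr // => /andP[? ?] /andP[? ?].
case: q => a b [/= h1 h2 h3 h4]; rewrite /pixel; congr pair; apply: floor_def;
by rewrite ler_pdivlMr // ltr_pdivrMr // ?h1 ?h2 ?h3 ?h4.
Qed.

Lemma inner_pixel i q x : inner i q x -> pixel i x = q.
Proof. by move=> [h1 h2 h3 h4]; apply/pixelP; split; lra. Qed.

Lemma chord_span_pixel c t : chord_span c t -> pixel (level c) (on_line c.1 t) = c.2.
Proof. exact: inner_pixel. Qed.

Lemma pixel_near i x y : pixel i x = pixel i y ->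
  `|x.1 - y.1| <= side i /\ `|x.2 - y.2| <= side i.
Proof.
move=> /pixelP[]; have /pixelP[] : pixel i y = pixel i y by [].
rewrite !intrD !mulrDl !mul1r => *; rewrite !ler_norml; split; lra.
Qed.

Lemma floor_div (s : R) (n : nat) (z : R) : 0 < s -> (0 < n)%N ->
  Num.floor (z / (n%:R * s)) = (Num.floor (z / s) %/ n%:Z)%Z.
Proof.
move=> s0 n0; apply: floor_def.
have n0' : 0 < n%:R :> R by rewrite ltr0n.
rewrite ler_pdivlMr ?mulr_gt0 // ltr_pdivrMr ?mulr_gt0 //.
have := floor_itv (z / s); rewrite ler_pdivlMr // ltr_pdivrMr //.
set m := Num.floor _ => /andP[h1 h2].
have h3 : (m %/ n%:Z)%Z * n%:Z <= m by lia.
have h4 : m + 1 <= ((m %/ n%:Z)%Z + 1) * n%:Z by lia.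
move: h3 h4; rewrite -(ler_int R) -(ler_int R (m + 1)) !intrM -!pmulrn => h3 h4.
rewrite !mulrA (le_trans _ h1) ?(lt_le_trans h2) // ler_pM2r //.
Qed.

(** The side 4^j is an integer multiple of 4^i, so the grids of squares are nested. *)
Lemma pixel_coarsen i j x y : (i <= j)%N -> pixel i x = pixel i y -> pixel j x = pixel j y.
Proof.
move=> ij [h1 h2]; rewrite /pixel.
have -> : side j = (4 ^ (j - i))%N%:R * side i.
  by rewrite /side natrX -exprD subnK.
by rewrite !floor_div ?side_gt0 ?expn_gt0 // h1 h2.
Qed.

Lemma inner_dist i q x y : inner i q x -> pixel i y <> q -> 110 <= norm2 (x - y).
Proof.
move=> [h1 h2 h3 h4] ny; apply: contrapT => /negP; rewrite -ltNge => h.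
have hx : `|x.1 - y.1| < 110.
  apply: le_lt_trans h; apply: norm2_ge; rewrite real_normK ?num_real //= lerDl; exact: sqr_ge0.
have hy : `|x.2 - y.2| < 110.
  apply: le_lt_trans h; apply: norm2_ge; rewrite real_normK ?num_real //= lerDr; exact: sqr_ge0.
by apply: ny; apply/pixelP; move: hx hy; rewrite !ltr_norml; split; lra.
Qed.

Section Built.
Context (J : nat) (built : chord_id -> Prop).
Hypothesis builtE : forall c,
  built c <-> valid J c /\ forall d, preferred J d c -> built d -> ~ obstructs c d.

(** The square of the less preferred chord is avoided by the other one, and its own points lie 110
    inside that square. *)
Lemma built_separated c d s t : built c -> built d -> chord_span c s -> chord_span d t ->
  c <> d -> 110 <= norm2 (on_line c.1 s - on_line d.1 t).
Proof.
have pref c' d' s' t' : preferred J d' c' -> built c' -> built d' ->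
    chord_span c' s' -> chord_span d' t' -> 110 <= norm2 (on_line c'.1 s' - on_line d'.1 t').
  move=> dc /builtE[_ nc] bd sc sd; apply: inner_dist sc _ => pe.
  by apply: (nc _ dc bd); exists t'.
move=> bc bd sc sd cd.
have [[cJ _] [dJ _]] : valid J c /\ valid J d by move: bc bd => /builtE[? _] /builtE[? _].
have [h|h] := preferred_total _ _ _ cJ dJ cd; last exact: pref h bc bd sc sd.
by rewrite dist2C; apply: pref h bd bc sd sc.
Qed.

(* A pixel of level i meets at most one chord of level at least i, since it lies
   in the pixel of the less preferred one. *)
Lemma built_unique i c d s t : built c -> built d -> chord_span c s -> chord_span d t ->
  (i <= level c)%N -> (i <= level d)%N ->
  pixel i (on_line c.1 s) = pixel i (on_line d.1 t) -> c = d.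
Proof.
have pref c' d' s' t' : preferred J d' c' -> built c' -> built d' ->
    chord_span c' s' -> chord_span d' t' -> (i <= level c')%N ->
    pixel i (on_line c'.1 s') = pixel i (on_line d'.1 t') -> False.
  move=> dc /builtE[_ nc] bd sc sd ic pe; apply: (nc _ dc bd); exists t' => //.
  by rewrite -(pixel_coarsen _ _ _ _ ic pe); exact: chord_span_pixel.
move=> bc bd sc sd ic id pe; apply: contrapT => cd.
have [[cJ _] [dJ _]] : valid J c /\ valid J d by move: bc bd => /builtE[? _] /builtE[? _].
have [h|h] := preferred_total _ _ _ cJ dJ cd; last exact: pref h bc bd sc sd ic pe.
exact: pref h bd bc sd sc id (esym pe).
Qed.

Lemma not_built_obstructed c : valid J c -> ~ built c ->
  exists d, [/\ preferred J d c, built d & obstructs c d].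
Proof.
move=> vc nc; apply: contrapT => h; apply: nc; apply/builtE; split=> // d dc bd cd.
by apply: h; exists d.
Qed.

End Built.

Lemma heading_ge1 i g : is_heading i g ->
  1 <= `|(heading i g).1| /\ 1 <= `|(heading i g).2|.
Proof.
move=> /and3P[_ og _]; have p0 : (0 < 2 ^ i)%N by rewrite expn_gt0.
by rewrite /heading; case: g.1 => /=; lia.
Qed.

Lemma heading_le i g : is_heading i g ->
  `|(heading i g).1| + `|(heading i g).2| <= 4 * (2 ^ i)%N%:Z.
Proof. by move=> /and3P[_ _ hg]; rewrite /heading; case: g.1 => /=; lia. Qed.

(** Compare powers of 2. For equal orientations 2^i b = a 2^j with a, b odd forces i = j and a = b;
    for opposite ones 2^(i + j) would be a product of two odd numbers. *)
Lemma heading_independent i j g h : is_heading i g -> is_heading j h ->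
  (i, g) <> (j, h) ->
  (heading i g).1 * (heading j h).2 - (heading i g).2 * (heading j h).1 <> 0.
Proof.
move=> /and3P[i0 og _] /and3P[j0 oh _] neq.
case: g h og oh neq => f a [f' b] /= oa ob neq.
have odd_pow k : k != 0%N -> odd (2 ^ k) = false by move=> k0; rewrite oddX (negPf k0).
have same m n (a' b' : int) : odd (absz a') -> odd (absz b') -> (m, a') <> (n, b') ->
    (2 ^ m)%N%:Z * b' <> a' * (2 ^ n)%N%:Z.
  wlog mn : m n a' b' / (m <= n)%N.
    by case: (leqP m n) => [mn H|/ltnW nm H oa' ob' ne e]; [exact: H|apply: (H n m b' a') => //; [move=> [h1 h2]; apply: ne; rewrite h1 h2|rewrite mulrC -e mulrC]].
  move=> oa' ob' ne; have := subnK mn; move: (n - m)%N => k nE; rewrite -nE expnD PoszM => e.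
  have {}e : b' = (2 ^ k)%N%:Z * a'.
    have p0 : (2 ^ m)%N%:Z != 0 by rewrite -lt0n expn_gt0.
    apply: (mulIf p0); rewrite mulrC e; ring.
  have [nm0|nm0] := eqVneq k 0%N.
    by apply: ne; rewrite e nm0 mul1r; congr pair; lia.
  by move: ob'; rewrite e abszM oddM /= (odd_pow _ nm0).
have mixed m n (a' b' : int) : (0 < m)%N -> odd (absz a') -> odd (absz b') ->
    (2 ^ m)%N%:Z * (2 ^ n)%N%:Z <> a' * b'.
  move=> m0 oa' ob' e.
  have : absz ((2 ^ m)%N%:Z * (2 ^ n)%N%:Z) = absz (a' * b') by rewrite e.
  by rewrite !abszM /= -expnD => /(congr1 odd); rewrite odd_pow ?oddM ?oa' ?ob' //; lia.
rewrite /heading /=; case: f f' neq => -[] neq /= /eqP; rewrite subr_eq0 => /eqP e.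
- by apply: (same i j a b) => //; move=> [h1 h2]; apply: neq; rewrite h1 h2.
- by apply: (mixed i j a b).
- by apply: (mixed i j a b).
- by apply: (same i j a b) => //; move=> [h1 h2]; apply: neq; rewrite h1 h2.
Qed.

End Levels.

(** * Travel along a line *)

Section IntegerFamilies.
Context {R : realType} {V : eqType} (e : rel V).

Lemma bypassable_int (x : nat -> V) (n : nat) (P : nat -> int -> Prop) (lo hi B : R) :
  (forall t k, (t < n)%N -> P t k -> lo <= k%:~R <= hi) ->
  (forall k, excursion (R := R) e x n ([set t | P t k], B)) -> lo <= hi ->
  bypassable (R := R) e x n [set t | exists k, P t k] ((hi - lo + 2) * B).
Proof.
move=> bd ex lohi; have [B0 _] := ex 0.
(* Counting upwards from the floor of [lo], these many integers reach past [hi]. *)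
pose N := (Num.trunc (hi - lo)).+2.
pose ks := [seq Num.floor lo + i%:Z | i <- iota 0 N].
pose Es := [seq ([set t | P t k], B) | k <- ks].
exists Es; split.
- by move=> E /mapP[k _ ->].
- move=> t tn [k Ptk]; exists ([set t | P t k], B) => //; apply: map_f.
  have /andP[h1 h2] := bd _ _ tn Ptk.
  have h3 : Num.floor lo <= k by rewrite -(ler_int R) (le_trans (floor_le _)).
  apply/mapP; exists (absz (k - Num.floor lo)); last by lia.
  rewrite mem_iota /= add0n /N.
  have /andP[_ h4] : ((Num.trunc (hi - lo))%:R <= hi - lo < (Num.trunc (hi - lo)).+1%:R)%R.
    by apply: truncn_itv; rewrite subr_ge0.
  have h5 := floorD1_gt lo.
  have : k < Num.floor lo + 1 + (Num.trunc (hi - lo)).+1%:Z.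
    rewrite -(ltr_int R) intrD -pmulrn; move: h5 h4 h2; rewrite !intrD; lra.
  by lia.
rewrite big_map big_const_seq iter_addr_0 count_predT size_map size_iota.
rewrite -[B *+ N]mulr_natl ler_wpM2r // /N -addn2 natrD lerD2r.
by rewrite truncn_le // subr_ge0.
Qed.

End IntegerFamilies.

Section LineGeometry.
Context {R : realType}.
Implicit Types (x y v : R * R).

Definition dot (v x : R * R) : R := v.1 * x.1 + v.2 * x.2.

Variables (l : line_id).
Hypothesis hl : is_heading l.1.1 l.1.2.

Let v : R * R := line_vec l.
Let u : R * R := line_dir l.
Let m : R := 2 ^+ l.1.1.

Lemma line_vec_ge1 : 1 <= `|v.1| /\ 1 <= `|v.2|.
Proof.
have [h1 h2] := heading_ge1 _ _ hl.
by rewrite /v /line_vec /emb /= -!intr_norm -[1]/(1%:~R) !ler_int.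
Qed.

Lemma line_vec_le : `|v.1| + `|v.2| <= 4 * m.
Proof.
have := heading_le _ _ hl; rewrite /v /line_vec /emb /= -!intr_norm -(ler_int R).
by rewrite intrD intrM -[((2 ^ _)%N%:Z)%:~R]pmulrn natrX.
Qed.

Lemma line_vec_norm_ge : m <= norm2 v.
Proof.
apply: norm2_ge; rewrite /v /line_vec /emb /heading /m.
case: l.1.2.1 => /=; rewrite -[((2 ^ _)%N%:Z)%:~R]pmulrn natrX; rewrite ?lerDl ?lerDr; exact: sqr_ge0.
Qed.

Lemma line_vec_norm_gt0 : 0 < norm2 v.
Proof. by apply: lt_le_trans line_vec_norm_ge; rewrite exprn_gt0. Qed.

Lemma line_vec_norm_le : norm2 v <= 4 * m.
Proof. exact: le_trans (norm2_le_taxi _) line_vec_le. Qed.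

Lemma line_dir_unit : u.1 ^+ 2 + u.2 ^+ 2 = 1.
Proof.
have n0 := line_vec_norm_gt0; rewrite /u /line_dir -/v /= !expr_div_n -mulrDl -(sqr_norm2 v).
by rewrite divff // expf_eq0 /= (gt_eqF n0).
Qed.

Lemma line_dir_neq0 : u.1 != 0 /\ u.2 != 0.
Proof.
have n0 := line_vec_norm_gt0; have [h1 h2] := line_vec_ge1.
rewrite /u /line_dir -/v /= !mulf_eq0 !invr_eq0 !(gt_eqF n0) !orbF.
by rewrite -(normr_gt0 v.1) -(normr_gt0 v.2) !(lt_le_trans ltr01).
Qed.

Lemma line_dir_ge : (4 * m)^-1 <= `|u.1| /\ (4 * m)^-1 <= `|u.2|.
Proof.
have n0 := line_vec_norm_gt0; have [h1 h2] := line_vec_ge1.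
have h3 := line_vec_norm_le; have m0 : 0 < m by rewrite exprn_gt0.
have key (a : R) : 1 <= `|a| -> (4 * m)^-1 <= `|a / norm2 v|.
  move=> a1; rewrite normrM normfV (gtr0_norm n0) -[leLHS]mul1r.
  by apply: ler_pM; rewrite ?invr_ge0 ?mulr_ge0 ?(ltW m0) // lef_pV2 // posrE mulr_gt0.
by split; apply: key.
Qed.

Lemma cross_line t : cross v (on_line l t) = l.2%:~R * spacing l.1.1.
Proof.
have n0 := line_vec_norm_gt0.
have s0 : v.1 ^+ 2 + v.2 ^+ 2 != 0 by rewrite -(sqr_norm2 v) expf_eq0 /= gt_eqF.
rewrite /cross /on_line /ideal /line_base /line_dir -/v /=.
by field; rewrite s0 gt_eqF.
Qed.

(** Split the difference along and across the line: rounding the projection costs 1, and the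
    distance to the line is at most spacing / |v| <= m^8 / m. *)
Lemma line_approx x : `|cross v x - l.2%:~R * spacing l.1.1| <= spacing l.1.1 ->
  norm2 (x - on_line l (Num.floor (dot u x))) <= m ^+ 7 + 1.
Proof.
move=> h; have n0 := line_vec_norm_gt0; have uu := line_dir_unit.
have m0 : 0 < m by rewrite exprn_gt0.
have s0 : v.1 ^+ 2 + v.2 ^+ 2 != 0 by rewrite -(sqr_norm2 v) expf_eq0 /= gt_eqF.
pose b : R := (cross v x - l.2%:~R * spacing l.1.1) / norm2 v.
have -> t : x - on_line l t = ((dot u x - t%:~R) * u.1, (dot u x - t%:~R) * u.2) + (- b * u.2, b * u.1).
  have e1 : v.1 = norm2 v * u.1 by rewrite /u /line_dir -/v /= mulrC divfK // gt_eqF.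
  have e2 : v.2 = norm2 v * u.2 by rewrite /u /line_dir -/v /= mulrC divfK // gt_eqF.
  have e3 : v.1 ^+ 2 + v.2 ^+ 2 = norm2 v ^+ 2 by rewrite sqr_norm2.
  rewrite /b /cross /dot /on_line /ideal /line_base -/v -/u e3 e1 e2.
  have nn : norm2 v != 0 by rewrite gt_eqF.
  have k1 : x.1 = x.1 * (u.1 ^+ 2 + u.2 ^+ 2) by rewrite uu mulr1.
  have k2 : x.2 = x.2 * (u.1 ^+ 2 + u.2 ^+ 2) by rewrite uu mulr1.
  move: (u.1) (u.2) (norm2 v) (l.2%:~R * spacing l.1.1) nn k1 k2 => w z n s nn k1 k2.
  case: x k1 k2 {h b} => c d /= k1 k2; congr pair => /=.
    by rewrite {1}k1; field.
  by rewrite {1}k2; field.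
set t := Num.floor _.
apply: le_trans (ler_norm2D _ _) _; rewrite addrC; apply: lerD.
  apply: norm2_le; first by rewrite exprn_ge0 // ltW.
  rewrite [X in X <= _](_ : _ = b ^+ 2 * (u.1 ^+ 2 + u.2 ^+ 2)); last by rewrite /=; ring.
  rewrite uu mulr1 -(real_normK (num_real b)) ler_pXn2r ?nnegrE ?exprn_ge0 ?(ltW m0) //.
  rewrite /b normrM normfV (gtr0_norm n0) ler_pdivrMr // (le_trans h) //.
  have -> : spacing l.1.1 = m ^+ 7 * m by rewrite /spacing /m exprM -exprSr -!exprM mulnC.
  by rewrite ler_pM2l ?exprn_gt0 // line_vec_norm_ge.
apply: norm2_le => //.
rewrite [X in X <= _](_ : _ = (dot u x - t%:~R) ^+ 2 * (u.1 ^+ 2 + u.2 ^+ 2)); last by rewrite /=; ring.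
rewrite uu mulr1; have := floor_itv (dot u x); rewrite -/t intrD => /andP[h1 h2].
by rewrite -subr_ge0; nra.
Qed.

End LineGeometry.

Lemma exists_line (R : realType) (v x : R * R) (i : nat) : exists k : int,
  `|cross v x - k%:~R * spacing i| <= spacing i.
Proof.
have s0 : 0 < spacing i :> R by rewrite exprn_gt0.
exists (Num.floor (cross v x / spacing i)).
have := floor_itv (cross v x / spacing i).
rewrite ler_pdivlMr // ltr_pdivrMr // intrD ler_norml => h; lra.
Qed.

Lemma dist_shift (R : realType) (a : int) (s t : nat) : (s <= t)%N ->
  `|a + s%:Z - (a + t%:Z)|%:~R = (t - s)%:R :> R.
Proof. by move=> st; rewrite pmulrn; congr (_%:~R); lia. Qed.

Lemma inner_neighbor (R : realType) (i : nat) (q : int * int) (x y : R * R) :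
  [/\ q.1%:~R * side i + 111 <= x.1, x.1 <= (q.1 + 1)%:~R * side i - 111,
      q.2%:~R * side i + 111 <= x.2 & x.2 <= (q.2 + 1)%:~R * side i - 111] ->
  `|y.1 - x.1| <= 1 -> `|y.2 - x.2| <= 1 -> inner i q x /\ inner i q y.
Proof. by rewrite !ler_norml => -[? ? ? ?] ? ?; split; split; lra. Qed.

Section TravelAlongLine.
Context {R : realType} (J : nat) (built : chord_id -> Prop).
Hypothesis builtE : forall c,
  built c <-> valid J c /\ forall d, preferred J d c -> built d -> ~ obstructs (R := R) c d.

Definition line_road (l : line_id) (t : int) : int * int :=
  road (line_base l : R * R) (line_dir l) t.

Definition chord_network : rel (int * int) :=
  network built (fun c => line_base c.1 : R * R) (fun c => line_dir c.1) (chord_span (R := R)).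

Local Notation net := chord_network.

Lemma built_heading c : built c -> is_heading c.1.1.1 c.1.1.2.
Proof. by move=> /builtE[[]]. Qed.

Let builtU c (bc : built c) := line_dir_unit (R := R) c.1.
Let built1 c (bc : built c) := (line_dir_neq0 (R := R) _ (built_heading _ bc)).1.
Let built2 c (bc : built c) := (line_dir_neq0 (R := R) _ (built_heading _ bc)).2.
Let builtS c d s t bc bd sc sd cd := built_separated _ _ builtE c d s t bc bd sc sd cd.

Lemma chord_network_sym : symmetric net.
Proof. exact: network_sym. Qed.

Lemma chord_network_king x y : net x y -> king x y.
Proof. exact: network_king builtU built1 built2 _ _. Qed.

Lemma chord_network_no_crossing : no_crossing net.
Proof. by apply: network_no_crossing builtU built1 built2 _ => c d s t *; exact: builtS. Qed.

Lemma chord_network_path p s : path net p s ->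
  norm2 (emb p - emb (last p s)) - 6 <= (size s)%:R :> R.
Proof. by apply: network_path_norm2 builtU built1 built2 _ _ _ => c d i t *; exact: builtS. Qed.

(** The factor 6 is 3 for the detours in the slow graph times 2 for taxicab against Euclidean
    distance. *)
Lemma chord_network_reach p q : reach (R := R) net (6 * norm2 (emb p - emb q : R * R)) p q.
Proof.
apply: reach_weak (network_reach_taxi _ _ _ _ p q); rewrite taxi_emb.
by have := taxi_le_norm2 (emb p - emb q : R * R); lra.
Qed.

Lemma chord_span_convex c s t w : chord_span (R := R) c s -> chord_span (R := R) c t ->
  s <= w <= t -> chord_span (R := R) c w.
Proof.
rewrite /chord_span /inner /on_line /ideal; move: (line_base c.1) (line_dir c.1) => b u /=.
move=> [h1 h2 h3 h4] [k1 k2 k3 k4] /andP[sw wt].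
have sw' : s%:~R <= w%:~R :> R by rewrite ler_int.
have wt' : w%:~R <= t%:~R :> R by rewrite ler_int.
have conv (p v lo hi : R) : lo <= p + s%:~R * v <= hi -> lo <= p + t%:~R * v <= hi ->
    lo <= p + w%:~R * v <= hi.
  move=> A B; have [v0|v0] := leP 0 v.
    have : s%:~R * v <= w%:~R * v by rewrite ler_wpM2r.
    have : w%:~R * v <= t%:~R * v by rewrite ler_wpM2r.
    by lra.
  have : w%:~R * v <= s%:~R * v by rewrite ler_wnM2r // ltW.
  have : t%:~R * v <= w%:~R * v by rewrite ler_wnM2r // ltW.
  by lra.
have /andP[? ?] := conv b.1 u.1 _ _ (introT andP (conj h1 h2)) (introT andP (conj k1 k2)).
have /andP[? ?] := conv b.2 u.2 _ _ (introT andP (conj h3 h4)) (introT andP (conj k3 k4)).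
by split.
Qed.

Lemma chord_reach c s t : built c -> chord_span (R := R) c s -> chord_span (R := R) c t ->
  reach (R := R) net `|s - t|%:~R (line_road c.1 s) (line_road c.1 t).
Proof.
move=> bc; wlog st : s t / s <= t => [H|] sc tc.
  have [st|ts] := leP s t; first exact: H.
  by rewrite distrC; apply: reach_sym chord_network_sym _; apply: H; rewrite // ltW.
have [n tE] : exists n : nat, t = s + n%:Z by exists (absz (t - s)); lia.
have -> : `|s - t|%:~R = n%:R :> R by rewrite tE pmulrn; congr (_%:~R); lia.
rewrite tE; apply: network_reach_road => // k kn.
apply: chord_span_convex sc tc _; rewrite tE; lia.
Qed.

Variable l : line_id.
Hypotheses (hl : is_heading l.1.1 l.1.2) (lJ : (l.1.1 <= J)%N).

Let u : R * R := line_dir l.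
Let uU := line_dir_unit (R := R) l.
Let u1 := (line_dir_neq0 (R := R) _ hl).1.
Let u2 := (line_dir_neq0 (R := R) _ hl).2.

Lemma line_road_near t : norm2 (emb (line_road l t) - on_line l t : R * R) <= 3.
Proof. exact: road_near_norm2. Qed.

Lemma built_road_near c t : built c -> norm2 (emb (line_road c.1 t) - on_line c.1 t : R * R) <= 3.
Proof. by move=> bc; apply: road_near_norm2; [exact: builtU|exact: built1|exact: built2]. Qed.

Lemma on_line_dist s t : norm2 (on_line l s - on_line l t : R * R) = `|s - t|%:~R.
Proof. exact: ideal_dist. Qed.

Lemma line_road_reach s t :
  reach (R := R) net (6 * `|s - t|%:~R) (line_road l s) (line_road l t).
Proof.
apply: reach_weak (network_reach_taxi _ _ _ _ _ _).
have /andP[_ h] := road_taxi (line_base l : R * R) _ uU u1 u2 s t.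
have -> : 6 * `|s - t|%:~R = 3 * (2 * `|s - t|)%:~R :> R by rewrite intrM; ring.
by rewrite ler_pM2l // ler_int.
Qed.

Variables (a : int) (n : nat).

Let x (t : nat) : int * int := line_road l (a + t%:Z).
Let P (t : nat) : R * R := on_line l (a + t%:Z).

Lemma cross_on_line (v : R * R) (t : nat) : cross v (P t) = cross v (P 0) + t%:R * cross v u.
Proof. by rewrite /cross /P /on_line /ideal -/u addr0 intrD -pmulrn /=; ring. Qed.

(* The steps near one line of the family span a length of at most
   2 E / `|cross v u|, so the slow graph is good enough to bypass them. *)
Lemma bypass_line_family (v : R * R) (s E : R) : cross v u != 0 -> 0 < s -> 0 <= E ->
  bypassable (R := R) net x n
    [set t | exists k : int, `|cross v (P t) - k%:~R * s| <= E]
    (((n%:R * `|cross v u| + 2 * E) / s + 2) * (6 * (2 * E / `|cross v u| + 1))).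
Proof.
move=> b0 s0 E0; set b := cross v u in b0 *.
have b0' : 0 < `|b| by rewrite normr_gt0.
have B0 : 0 <= 2 * E / `|b| by rewrite divr_ge0 ?mulr_ge0 // ltW.
pose g0 := cross v (P 0); pose lo := Num.min g0 (g0 + n%:R * b).
have n0 : 0 <= n%:R :> R by [].
have loE : lo = g0 + Num.min 0 (n%:R * b) by rewrite addr_minr addr0.
have span_g (t : nat) : (t < n)%N -> lo <= cross v (P t) <= lo + n%:R * `|b|.
  move=> tn; rewrite cross_on_line -/b -/g0 loE.
  have t0 : 0 <= (t%:R : R) <= n%:R by rewrite ler0n ler_nat ltnW.
  have [bp|bn] := leP 0 b.
    rewrite (min_idPl _) ?mulr_ge0 // (ger0_norm bp).
    have : 0 <= t%:R * b <= n%:R * b by rewrite mulr_ge0 ?ler_wpM2r //; case/andP: t0.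
    by lra.
  rewrite (min_idPr _) ?mulr_ge0_le0 ?(ltW bn) // (ltr0_norm bn).
  have : n%:R * b <= t%:R * b <= 0.
    by rewrite ler_wnM2r ?mulr_ge0_le0 ?(ltW bn) //; case/andP: t0.
  by lra.
have := @bypassable_int R _ net x n (fun t k => `|cross v (P t) - k%:~R * s| <= E)
  ((lo - E) / s) ((lo + n%:R * `|b| + E) / s) (6 * (2 * E / `|b| + 1)).
have -> : (lo + n%:R * `|b| + E) / s - (lo - E) / s = (n%:R * `|b| + 2 * E) / s.
  by rewrite -mulrBl; congr (_ / _); ring.
apply.
- move=> t k tn h; rewrite ler_pdivrMr // ler_pdivlMr //.
  by have := span_g t tn; move: h; rewrite ler_norml; lra.
- move=> k; split=> /=; first by rewrite mulr_ge0 // addr_ge0.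
  move=> t t' /andP[tt t'n] ht ht'.
  apply: reach_weak (line_road_reach _ _).
  rewrite dist_shift ?(leqW tt) //.
  have dt : (t'%:R - t%:R) * `|b| <= 2 * E.
    have -> : (t'%:R - t%:R) * `|b| = `|cross v (P t') - cross v (P t)|.
      rewrite (cross_on_line v t') (cross_on_line v t) -/b.
      rewrite -[X in X * _]ger0_norm ?subr_ge0 ?ler_nat // -normrM; congr (`|_|); ring.
    have := ler_distD (k%:~R * s) (cross v (P t')) (cross v (P t)).
    by rewrite (distrC (k%:~R * s) (cross v (P t))); lra.
  rewrite natrB ?(leqW tt) // -natr1.
  have : t'%:R - t%:R <= 2 * E / `|b| by rewrite ler_pdivlMr.
  have : 0 <= t'%:R - t%:R :> R by rewrite subr_ge0 ler_nat.
  by lra.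
- rewrite ler_pM2r ?invr_gt0 // -addrA lerD2l.
  have : 0 <= n%:R * `|b| by rewrite mulr_ge0.
  by lra.
Qed.


Let j : nat := l.1.1.

(** With the sign of the direction as a factor, the coordinates of the square never decrease along
    the line. *)
Lemma signed_floor_monotone (p v w : R) (s t : nat) : 0 < w -> (s <= t)%N ->
  sgz v * Num.floor ((p + s%:R * v) / w) <= sgz v * Num.floor ((p + t%:R * v) / w).
Proof.
move=> w0 st; have st' : s%:R <= t%:R :> R by rewrite ler_nat.
case: (sgzP v) => [_|v0|v0]; rewrite ?mul0r ?mul1r ?mulN1r // ?lerN2; apply: le_floor;
  by rewrite ler_pM2r ?invr_gt0 // lerD2l ?(ler_pM2r v0) ?(ler_nM2r v0).
Qed.

Lemma signed_floor_bound (p v w : R) (t : nat) : 0 < w -> `|v| <= 1 -> (t < n)%N ->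
  (sgz v)%:~R * p / w - 1 <= (sgz v * Num.floor ((p + t%:R * v) / w))%:~R
    <= (sgz v)%:~R * p / w + n%:R / w + 1.
Proof.
move=> w0 v1 tn; have := floor_itv ((p + t%:R * v) / w); rewrite intrM intrD mulrDl.
move: (Num.floor _)%:~R => F.
have n0 : 0 <= (t%:R : R) <= n%:R by rewrite ler0n ler_nat ltnW.
have i0 : 0 < w^-1 by rewrite invr_gt0.
have : 0 <= t%:R * `|v| / w <= n%:R / w.
  by rewrite !mulr_ge0 ?invr_ge0 ?(ltW w0) //= ler_pM2r // -[leRHS]mulr1 ler_pM //; case/andP: n0.
case: (sgzP v) => [->|vp|vn].
- by rewrite !mulr0z !mulr0 !mul0r; lra.
- by rewrite !mulr1z !mul1r; lra.
- by rewrite !mulrN1z !mulN1r !mulrN !mulNr; lra.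
Qed.

Definition detoured (t : nat) : Prop :=
  exists d, [/\ built d, (2 * j <= level d)%N &
    exists2 s, chord_span (R := R) d s & pixel j (on_line d.1 s : R * R) = pixel j (P t)].

(* In a pixel of level 2j all detours follow the same chord, which is straight
   and therefore as fast as l itself. *)
Lemma bypass_long_chords : bypassable (R := R) net x n detoured
  ((2 * n%:R / side (2 * j) + 6) * (120 * side j)).
Proof.
pose w : R := side (2 * j); have w0 : 0 < w by exact: side_gt0.
pose W : R := side j; have W1 : 1 <= W by rewrite exprn_ege1 // ler1n.
(* Both labels are nondecreasing, so their sum is constant only while the square of level [2 * j]
   is; the sum thus numbers the squares visited by integers. *)
pose lab1 (t : nat) : int := sgz u.1 * Num.floor ((P t).1 / w).
pose lab2 (t : nat) : int := sgz u.2 * Num.floor ((P t).2 / w).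
have P1 t : (P t).1 = (P 0).1 + t%:R * u.1.
  by rewrite /P /on_line /ideal -/u addr0 intrD -pmulrn /=; ring.
have P2 t : (P t).2 = (P 0).2 + t%:R * u.2.
  by rewrite /P /on_line /ideal -/u addr0 intrD -pmulrn /=; ring.
have [v1 v2] : `|u.1| <= 1 /\ `|u.2| <= 1.
  have := uU; rewrite -/u -(real_normK (num_real u.1)) -(real_normK (num_real u.2)).
  by have := normr_ge0 u.1; have := normr_ge0 u.2; split; nra.
have mono s t : (s <= t)%N -> lab1 s <= lab1 t /\ lab2 s <= lab2 t.
  by move=> st; rewrite /lab1 /lab2 (P1 s) (P1 t) (P2 s) (P2 t); split; exact: signed_floor_monotone.
have same s t : (s <= t)%N -> lab1 s + lab2 s = lab1 t + lab2 t ->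
    pixel (2 * j) (P s) = pixel (2 * j) (P t).
  move=> st e; have [m1 m2] := mono _ _ st.
  have [e1 e2] : lab1 s = lab1 t /\ lab2 s = lab2 t.
    move: (lab1 s) (lab1 t) (lab2 s) (lab2 t) m1 m2 e; clear => *; lia.
  rewrite /pixel -/w; congr pair.
    by apply: (mulfI _ e1); rewrite sgz_eq0.
  by apply: (mulfI _ e2); rewrite sgz_eq0.
pose lo : R := (sgz u.1)%:~R * (P 0).1 / w - 1 + ((sgz u.2)%:~R * (P 0).2 / w - 1).
pose hi : R := (sgz u.1)%:~R * (P 0).1 / w + n%:R / w + 1 + ((sgz u.2)%:~R * (P 0).2 / w + n%:R / w + 1).
have hilo : hi - lo + 2 = 2 * n%:R / w + 6 by rewrite /hi /lo; ring.
have nw : 0 <= n%:R / w by rewrite divr_ge0 // ltW.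
pose Q (t : nat) (k : int) := detoured t /\ lab1 t + lab2 t = k.
have bounds (t : nat) (k : int) : (t < n)%N -> Q t k -> lo <= k%:~R <= hi.
  move=> tn [_ <-]; rewrite intrD /lab1 /lab2 P1 P2.
  have := signed_floor_bound (P 0).1 u.1 w t w0 v1 tn.
  have := signed_floor_bound (P 0).2 u.2 w t w0 v2 tn.
  by rewrite /lo /hi; lra.
have ex (k : int) : excursion (R := R) net x n ([set t | Q t k], 120 * W).
  split=> /=; first by rewrite mulr_ge0 // (le_trans ler01).
  move=> s t /andP[st tn] [[c [bc jc [i si ei]]] ks] [[d [bd jd [i' si' ei']]] kt].
  have jj : (j <= 2 * j)%N by rewrite leq_pmull.
  have cd : c = d.
    apply: (built_unique _ _ builtE (2 * j)) si si' _ _ _ => //.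
    rewrite (pixel_coarsen _ _ _ _ jj ei) (pixel_coarsen _ _ _ _ jj ei').
    by apply: same => //; rewrite ks kt.
  subst d; have near z (q : R * R) : pixel j (on_line c.1 z : R * R) = pixel j q -> norm2 (on_line c.1 z - q) <= 2 * W.
    move=> e; have [h1 h2] := pixel_near _ _ _ e; apply: le_trans (norm2_le_taxi _) _; rewrite -/W in h1 h2 *; lra.
  have n1 := near _ _ ei; have n2 := near _ _ ei'.
  have b1 := built_road_near c i bc; have b2 := built_road_near c i' bc.
  have r1 := line_road_near (a + s%:Z); have r2 := line_road_near (a + t.+1%:Z).
  have pst := on_line_dist (a + s%:Z) (a + t%:Z).
  have ptt := on_line_dist (a + t%:Z) (a + t.+1%:Z).
  have cii : norm2 (on_line c.1 i - on_line c.1 i' : R * R) = `|i - i'|%:~R.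
    by apply: ideal_dist; exact: builtU.
  have ts : `|a + s%:Z - (a + t%:Z)|%:~R = t%:R - s%:R :> R.
    by rewrite dist_shift // natrB.
  have tt : `|a + t%:Z - (a + t.+1%:Z)|%:~R = 1 :> R.
    by rewrite dist_shift // subSnn.
  rewrite ts in pst; rewrite tt in ptt.
  rewrite -/(P s) -/(P t) in pst ptt *; rewrite -/(P s) -/(P t.+1) -/(x s) -/(x t.+1) in r1 r2 ptt *.
  have d1 : norm2 (emb (x s) - emb (line_road c.1 i) : R * R) <= 6 + 2 * W.
    have := ler_dist2 (emb (x s)) (P s) (emb (line_road c.1 i)).
    have := ler_dist2 (P s) (on_line c.1 i) (emb (line_road c.1 i)).
    by rewrite (dist2C (P s) (on_line _ _)) (dist2C (on_line c.1 i) (emb _)); lra.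
  have d2 : norm2 (emb (line_road c.1 i') - emb (x t.+1) : R * R) <= 7 + 2 * W.
    have := ler_dist2 (emb (line_road c.1 i')) (on_line c.1 i' : R * R) (emb (x t.+1)).
    have := ler_dist2 (on_line c.1 i') (P t) (emb (x t.+1)).
    have := ler_dist2 (P t) (P t.+1) (emb (x t.+1)).
    by rewrite (dist2C (P t.+1) (emb _)); lra.
  have d3 : `|i - i'|%:~R <= t%:R - s%:R + 4 * W :> R.
    rewrite -cii; have := ler_dist2 (on_line c.1 i) (P s) (on_line c.1 i').
    have := ler_dist2 (P s) (P t) (on_line c.1 i').
    by rewrite (dist2C (P t) (on_line _ _)); lra.
  (* Hop to the chord, follow it, hop back: the overhead is at most 28 W + 78 <= 120 W. *)
  apply: (@reach_weak _ _ _ (6 * norm2 (emb (x s) - emb (line_road c.1 i) : R * R) +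
    (`|i - i'|%:~R + 6 * norm2 (emb (line_road c.1 i') - emb (x t.+1) : R * R)))).
    rewrite natrB ?(leqW st) // -natr1; lra.
  apply: reach_trans (chord_network_reach _ _) _.
  by apply: reach_trans (chord_reach _ _ _ bc si si') (chord_network_reach _ _).
have lohi : lo <= hi by rewrite -subr_ge0; lra.
rewrite -hilo; apply: bypassable_weaken (bypassable_int _ _ _ _ _ _ _ bounds ex lohi) => // t dt.
by exists (lab1 t + lab2 t).
Qed.


Let g := l.1.2.
Let m : R := 2 ^+ j.

Lemma line_level_gt0 : (0 < j)%N.
Proof. by have /and3P[] := hl. Qed.

Lemma scale_ge1 : 1 <= m.
Proof. by rewrite exprn_ege1 // ler1n. Qed.

Lemma side_sqr : side j = m ^+ 2.
Proof. by rewrite /side /m exprAC; congr (_ ^+ _); rewrite expr2 -natrM. Qed.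

(* The lines of level i are 2^(7 i) apart, and they meet l at an angle of at
   least about 2^(- i - j). *)
Lemma bypass_crossing_lines i h : is_heading i h -> (i, h) <> (j, g) -> (j <= i < 2 * j)%N ->
  bypassable (R := R) net x n
    [set t | exists k : int,
       `|cross (emb (heading i h)) (P t) - k%:~R * spacing i| <= 4 * 2 ^+ i * side j]
    (72 * (n%:R / m ^+ 5) + 2000 * m ^+ 5).
Proof.
move=> hi neq /andP[ji ij]; set v : R * R := emb (heading i h).
pose M : R := 2 ^+ i; have m1 := scale_ge1; have m0 : 0 < m := lt_le_trans ltr01 m1.
have mM : m <= M by rewrite ler_weXn2l // ler1n.
have Mm : M <= m ^+ 2 by rewrite /M /m -exprM ler_weXn2l ?ler1n // mulnC ltnW.
have M0 : 0 < M := lt_le_trans m0 mM.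
have n0 := line_vec_norm_gt0 (R := R) l.
have crossE : cross v u = cross v (line_vec l) / norm2 (line_vec l).
  rewrite /u /line_dir; cbv zeta; clearbody v; move: (line_vec l) => w.
  by move: (norm2 w) => N; rewrite /cross /=; ring.
(* This determinant is a nonzero integer, which bounds the angle between the lines from below. *)
have cross_ge : 1 <= `|cross v (line_vec l)|.
  have := heading_independent _ _ _ _ hi hl neq.
  rewrite /cross /v /line_vec /emb /= -!intrM -intrB -intr_norm -[1]/(1%:~R) ler_int.
  by move: (_ - _); clear => z; lia.
pose b := `|cross v u|.
have b_ge : (4 * m)^-1 <= b.
  rewrite /b crossE normrM normfV (gtr0_norm n0) -[leLHS]mul1r.
  apply: ler_pM; rewrite ?invr_ge0 ?mulr_ge0 ?(ltW m0) // lef_pV2 ?posrE ?mulr_gt0 //.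
  exact: line_vec_norm_le.
have b0 : 0 < b by apply: lt_le_trans b_ge; rewrite invr_gt0 mulr_gt0.
have [v1 v2] : `|u.1| <= 1 /\ `|u.2| <= 1.
  have := uU; rewrite -/u -(real_normK (num_real u.1)) -(real_normK (num_real u.2)).
  by have := normr_ge0 u.1; have := normr_ge0 u.2; split; nra.
have vle : `|v.1| + `|v.2| <= 4 * M.
  have := heading_le _ _ hi; rewrite /v /emb /= -!intr_norm -(ler_int R).
  by rewrite intrD intrM -[((2 ^ _)%N%:Z)%:~R]pmulrn natrX.
have b_le : b <= 4 * M.
  apply: le_trans vle; rewrite /b /cross (le_trans (ler_normB _ _)) // (normrM v.1) (normrM v.2).
  by apply: lerD; rewrite -[leRHS]mulr1 ler_wpM2l //.
have E0 : 0 <= 4 * M * side j by rewrite !mulr_ge0 ?(ltW M0) ?(ltW (side_gt0 _)).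
have s0 : 0 < spacing i :> R by rewrite exprn_gt0.
have c0 : cross v u != 0 by rewrite -normr_gt0.
apply: bypassable_weaken (bypass_line_family v (spacing i) _ c0 s0 E0); first exact: subset_refl.
rewrite -/b side_sqr (_ : spacing i = M ^+ 8); last by rewrite /spacing /M exprM -!exprM mulnC.
set E := 4 * M * m ^+ 2.
have Mn k : 0 < M ^+ k by rewrite exprn_gt0.
have mn k : 0 < m ^+ k by rewrite exprn_gt0.
have N0 : 0 <= n%:R :> R by [].
(* The product of the number of lines and the cost per line is expanded and bounded term by term; in
   the main term [b] cancels, since a flatter angle makes crossings longer but rarer. *)
have AC : n%:R * b / M ^+ 8 * (2 * E / b) <= 8 * (n%:R / m ^+ 5).
  have -> : n%:R * b / M ^+ 8 * (2 * E / b) = 8 * (n%:R * (m ^+ 2 / M ^+ 7)).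
    by rewrite /E; field; rewrite !gt_eqF.
  rewrite ler_pM2l // ler_wpM2l // ler_pdivrMr // mulrC ler_pdivlMr // -exprD.
  by rewrite lerXn2r // nnegrE ltW.
have A : n%:R * b / M ^+ 8 <= 4 * (n%:R / m ^+ 5).
  apply: (@le_trans _ _ (n%:R * (4 * M) / M ^+ 8)).
    by rewrite ler_pM2r ?invr_gt0 // ler_wpM2l.
  have -> : n%:R * (4 * M) / M ^+ 8 = 4 * (n%:R * (M ^+ 7)^-1) by field; rewrite gt_eqF.
  rewrite ler_pM2l // ler_wpM2l // lef_pV2 ?posrE //.
  apply: (@le_trans _ _ (m ^+ 7)); first by rewrite ler_weXn2l.
  by rewrite lerXn2r // nnegrE ltW.
have B : 2 * E / M ^+ 8 <= 8.
  have -> : 2 * E / M ^+ 8 = 8 * (m ^+ 2 / M ^+ 7) by rewrite /E; field; rewrite gt_eqF.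
  rewrite -[leRHS]mulr1 ler_pM2l // ler_pdivrMr // mul1r.
  apply: (@le_trans _ _ (m ^+ 7)); first by rewrite ler_weXn2l.
  by rewrite lerXn2r // nnegrE ltW.
have C : 2 * E / b <= 32 * m ^+ 5.
  rewrite ler_pdivrMr //; apply: (@le_trans _ _ (32 * m ^+ 5 * (4 * m)^-1)); last first.
    by rewrite ler_wpM2l // mulr_ge0 // ltW.
  have -> : 32 * m ^+ 5 * (4 * m)^-1 = 8 * m ^+ 2 * m ^+ 2 by field; rewrite gt_eqF.
  have -> : 2 * E = 8 * m ^+ 2 * M by rewrite /E; ring.
  by rewrite ler_wpM2l // mulr_ge0 // ltW.
have m5 : 1 <= m ^+ 5 by rewrite exprn_ege1.
have E2 : 0 <= 2 * E by rewrite mulr_ge0 // /E -side_sqr.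
have C0 : 0 <= 2 * E / b by rewrite divr_ge0 // ltW.
have B0 : 0 <= 2 * E / M ^+ 8 by rewrite divr_ge0 // ltW.
have BC : 2 * E / M ^+ 8 * (2 * E / b + 1) <= 8 * (32 * m ^+ 5 + 1).
  by apply: ler_pM => //; [rewrite addr_ge0 | rewrite lerD2r].
rewrite [(_ + 2 * _) / _]mulrDl; move: AC A B C BC C0 B0.
move: (n%:R * b / M ^+ 8) (2 * E / M ^+ 8) (2 * E / b) => X Y Z *.
by nra.
Qed.

(** These are the margins of the squares: 111 is the margin 110 plus one step. The angle with the
    axes is at least about 1 / (4 m), and in the main term it cancels. *)
Lemma bypass_grid_lines (v : R * R) : `|cross v u| = `|u.1| \/ `|cross v u| = `|u.2| ->
  bypassable (R := R) net x n
    [set t | exists k : int, `|cross v (P t) - k%:~R * side j| <= 111]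
    (1400 * (n%:R / m ^+ 2) + 1400 * 1000 * m).
Proof.
move=> crossE; pose b := `|cross v u|; have [d1 d2] := line_dir_ge (R := R) _ hl.
have m1 := scale_ge1; have m0 : 0 < m := lt_le_trans ltr01 m1.
have [v1 v2] : `|u.1| <= 1 /\ `|u.2| <= 1.
  have := uU; rewrite -/u -(real_normK (num_real u.1)) -(real_normK (num_real u.2)).
  by have := normr_ge0 u.1; have := normr_ge0 u.2; split; nra.
have [b_ge b_le] : (4 * m)^-1 <= b /\ b <= 1 by rewrite /b; case: crossE => ->.
have b0 : 0 < b by apply: lt_le_trans b_ge; rewrite invr_gt0 mulr_gt0.
have c0 : cross v u != 0 by rewrite -normr_gt0.
have E0 : 0 <= 111 :> R by [].
apply: bypassable_weaken (bypass_line_family v _ _ c0 (side_gt0 j) E0); first exact: subset_refl.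
rewrite -/b side_sqr.
have mn k : 0 < m ^+ k by rewrite exprn_gt0.
have N0 : 0 <= n%:R :> R by [].
have AC : n%:R * b / m ^+ 2 * (2 * 111 / b) = 222 * (n%:R / m ^+ 2).
  by field; rewrite !gt_eqF.
have A : n%:R * b / m ^+ 2 <= n%:R / m ^+ 2.
  by rewrite ler_pM2r ?invr_gt0 // -[leRHS]mulr1 ler_wpM2l.
have B : 2 * 111 / m ^+ 2 <= 222.
  rewrite ler_pdivrMr //; have : 1 <= m ^+ 2 by rewrite exprn_ege1.
  by lra.
have C : 2 * 111 / b <= 888 * m.
  have mb : 1 <= 4 * m * b by rewrite -ler_pdivrMl ?mulr_gt0 // mulr1.
  rewrite ler_pdivrMr //; lra.
have C0 : 0 <= 2 * 111 / b by rewrite divr_ge0 ?(ltW b0).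
have B0 : 0 <= 2 * 111 / m ^+ 2 by rewrite divr_ge0 ?(ltW (mn _)).
have BC : 2 * 111 / m ^+ 2 * (2 * 111 / b + 1) <= 222 * (888 * m + 1).
  by apply: ler_pM => //; [rewrite addr_ge0 | rewrite lerD2r].
rewrite [(_ + 2 * _) / _]mulrDl; move: AC A B C BC C0 B0.
move: (n%:R * b / m ^+ 2) (2 * 111 / m ^+ 2) (2 * 111 / b) => X Y Z *.
by nra.
Qed.


Lemma on_line_step t : `|(P t.+1).1 - (P t).1| <= 1 /\ `|(P t.+1).2 - (P t).2| <= 1.
Proof.
have : norm2 (P t.+1 - P t) = 1 by rewrite dist2C /P on_line_dist dist_shift // subSnn.
move: (P t.+1) (P t) => y z h; have := sqr_norm2 (y - z); rewrite h expr1n => e.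
have := sqr_ge0 (y - z).1; have := sqr_ge0 (y - z).2; rewrite !ler_norml /= in e *.
by split; apply/andP; split; nra.
Qed.

Let near_grid (v : R * R) : set nat :=
  [set t | exists k : int, `|cross v (P t) - k%:~R * side j| <= 111].

Let near_line (f : nat * (bool * int)) : set nat :=
  [set t | exists k : int,
     `|cross (emb (heading f.1 f.2)) (P t) - k%:~R * spacing f.1| <= 4 * 2 ^+ f.1 * side j].

Definition labels (N : nat) : seq (bool * int) :=
  [seq (b, z%:Z - N%:Z) | b <- [:: true; false], z <- iota 0 (2 * N).+1].

Lemma mem_labels (N : nat) h : (absz h.2 <= N)%N -> h \in labels N.
Proof.
case: h => b k /= kN; apply/allpairsP; exists (b, absz (k + N%:Z)).
by split; [case: b | rewrite mem_iota /=; lia | congr pair => /=; lia].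
Qed.

(** The levels run from j to 2 j - 1, and one list of labels large enough for all of them is
    filtered. The heading of [l] itself is left out, as its lines are parallel to [l]. *)
Definition crossing_families : seq (nat * (bool * int)) :=
  [seq f <- [seq (i, h) | i <- iota j j, h <- labels (3 * 2 ^ (2 * j))]
   | is_heading f.1 f.2 && (f != (j, g))].

Lemma mem_crossing_families i h : is_heading i h -> (i, h) <> (j, g) -> (j <= i < 2 * j)%N ->
  (i, h) \in crossing_families.
Proof.
move=> hi neq ij; rewrite mem_filter; apply/andP; split; first by rewrite /= hi; exact/eqP.
apply/allpairsP; exists (i, h); split=> //; first by rewrite /= mem_iota addnn -mul2n.
apply: mem_labels; case/and3P: hi => _ _ /leq_trans; apply.
by rewrite leq_mul2l leq_exp2l //; case/andP: ij => _ /ltnW.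
Qed.

Lemma size_crossing_families : (size crossing_families <= 14 * (2 ^ j) ^ 3)%N.
Proof.
rewrite size_filter (leq_trans (count_size _ _)) // !size_allpairs !size_iota /=.
have : (j <= 2 ^ j)%N by rewrite ltnW // ltn_expl.
have -> : (2 ^ (2 * j) = 2 ^ j * 2 ^ j)%N by rewrite -expnD addnn mul2n.
by have : (0 < 2 ^ j)%N by [rewrite expn_gt0]; move: (2 ^ j)%N => q; clear; nia.
Qed.

(** Away from the margins the step lies inside one square. If the chord of [l] there is missing,
    some preferred chord [d] enters the square: it is long (level at least 2 j), or its line is one
    of the crossing families, or it is parallel to [l], which is impossible. *)
Lemma travel_step t : (t < n)%N -> reach (R := R) net 1 (x t) (x t.+1) \/
  (detoured `|` (near_grid (1, 0) `|` near_grid (0, 1)) `|`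
   [set t | exists2 f, f \in crossing_families & near_line f t]) t.
Proof.
move=> tn; have [ng1|ng1] := pselect (near_grid (1, 0) t); first by right; left; right; left.
have [ng2|ng2] := pselect (near_grid (0, 1) t); first by right; left; right; right.
pose q := pixel j (P t); have /pixelP[q1 q2 q3 q4] : pixel j (P t) = q by [].
have far (z : R) (k : int) : ~ (exists k : int, `|z - k%:~R * side j| <= 111) ->
    k%:~R * side j <= z -> z < (k + 1)%:~R * side j ->
    k%:~R * side j + 111 <= z /\ z <= (k + 1)%:~R * side j - 111.
  move=> nz kz zk; split; rewrite leNgt; apply/negP => lt; apply: nz.
    by exists k; rewrite ler_norml; lra.
  by exists (k + 1); rewrite ler_norml; lra.
have [f3 f4] : q.2%:~R * side j + 111 <= (P t).2 /\ (P t).2 <= (q.2 + 1)%:~R * side j - 111.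
  apply: far => // -[k hk]; apply: ng1; exists k.
  by rewrite /cross /= mul1r mul0r subr0.
have [f1 f2] : q.1%:~R * side j + 111 <= (P t).1 /\ (P t).1 <= (q.1 + 1)%:~R * side j - 111.
  (* [cross (0, 1)] is minus the first coordinate, hence the sign of the witness. *)
  apply: far => // -[k hk]; apply: ng2; exists (- k).
  have -> : cross (0, 1) (P t) - (- k)%:~R * side j = - ((P t).1 - k%:~R * side j).
    by rewrite /cross intrN; move: (P t) => y /=; ring.
  by rewrite normrN.
pose c : chord_id := (l, q).
have [s1 s2] : chord_span (R := R) c (a + t%:Z) /\ chord_span (R := R) c (a + t.+1%:Z).
  have [e1 e2] := on_line_step t.
  change (inner j q (P t) /\ inner j q (P t.+1)).
  by apply: inner_neighbor e1 e2; split.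
have vc : valid J c by [].
have [bc|nbc] := pselect (built c).
  left; have := chord_reach c _ _ bc s1 s2.
  by rewrite dist_shift // subSnn.
right; have [d [dc bd [s sd pe]]] := not_built_obstructed _ _ builtE _ vc nbc.
have jd : (j <= level d)%N by case: dc => _ [/ltnW|[<- _]].
have [dj|dj] := leqP (2 * j) (level d).
  by left; left; exists d; split=> //; exists s.
have hd := built_heading _ bd.
have near : `|cross (emb (heading (level d) d.1.1.2)) (P t) - d.1.2%:~R * spacing (level d)|
    <= 4 * 2 ^+ level d * side j.
  have -> : d.1.2%:~R * spacing (level d) =
      cross (emb (heading (level d) d.1.1.2)) (on_line d.1 s) :> R by rewrite -(cross_line d.1 s).
  have [n1 n2] := pixel_near _ _ _ (pe : pixel j (on_line d.1 s : R * R) = pixel j (P t)).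
  have hv : `|(emb (heading (level d) d.1.1.2) : R * R).1| +
      `|(emb (heading (level d) d.1.1.2) : R * R).2| <= 4 * 2 ^+ level d.
    exact: (line_vec_le (R := R) d.1 hd).
  move: (emb _) (on_line d.1 s) (P t) hv n1 n2 => v y z hv n1 n2.
  have -> : cross v z - cross v y = v.2 * (y.1 - z.1) - v.1 * (y.2 - z.2) by rewrite /cross; ring.
  apply: le_trans (ler_normB _ _) _; rewrite !normrM.
  apply: (@le_trans _ _ ((`|v.1| + `|v.2|) * side j)); last by rewrite ler_wpM2r // ltW // side_gt0.
  by rewrite addrC mulrDl; apply: lerD; rewrite ler_wpM2l.
have [fam|nfam] := eqVneq (level d, d.1.1.2) (j, g); last first.
  right; exists (level d, d.1.1.2); last by exists d.1.2.
  by apply: mem_crossing_families => //; [exact/eqP | rewrite jd].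
(* The same line in the same square is [c] itself; another parallel would need m^8 <= 4 m^3,
   although m >= 2. *)
exfalso; case: fam => ed eg.
have dl1 : d.1.1 = l.1.
  by move: ed eg; rewrite /level /j /g; case: (d.1.1) => ? ? /= -> ->; case: (l.1).
have [kk|kk] := eqVneq d.1.2 l.2.
  have dE : d.1 = l by case: (d.1) (l) dl1 kk => ? ? [? ?] /= -> ->.
  have d2 : d.2 = q.
    have := chord_span_pixel _ _ sd; rewrite ed; move=> <-; exact: pe.
  have ddc : d = c by rewrite /c -dE -d2; case: (d).
  by case: dc; rewrite ddc => _ [|[_]]; rewrite ltnn.
have : `|cross (line_vec d.1) (P t) - d.1.2%:~R * spacing d.1.1.1| <= 4 * 2 ^+ d.1.1.1 * side j := near.
rewrite /line_vec dl1 -/(line_vec l) cross_line -mulrBl normrM side_sqr => {}near.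
have sp : spacing l.1.1 = m ^+ 8 :> R by rewrite /spacing /m -/j exprM -!exprM mulnC.
have m0 : 0 < m by rewrite (lt_le_trans ltr01) ?scale_ge1.
have sp0 : 0 < m ^+ 8 by rewrite exprn_gt0.
rewrite sp (gtr0_norm sp0) in near.
have k1 : 1 <= `|l.2%:~R - d.1.2%:~R| :> R.
  rewrite -intrB -intr_norm -[1]/(1%:~R) ler_int.
  by move/eqP: kk; move: (l.2) (d.1.2); clear => *; lia.
have m2 : 2 <= m by rewrite /m -[leLHS]expr1 ler_weXn2l ?ler1n // line_level_gt0.
have : m ^+ 8 <= 4 * m ^+ 3.
  apply: (@le_trans _ _ (4 * m * m ^+ 2)); last by rewrite -mulrA -exprS.
  apply: le_trans near; rewrite -[leLHS]mul1r; apply: ler_wpM2r => //.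
  exact: ltW.
have -> : m ^+ 8 = m ^+ 5 * m ^+ 3 by rewrite -exprD.
rewrite ler_pM2r ?exprn_gt0 //.
have : 2 ^+ 5 <= m ^+ 5 by rewrite lerXn2r // nnegrE ltW.
by rewrite !exprS expr0 mulr1; lra.
Qed.

(** The overheads of all obstacles are added. At most 14 m^3 crossing families cost O(n / m^5 + m^5)
    each, which is the source of the term m^8. *)
Lemma line_travel : reach (R := R) net
  (n%:R + (5000 * (n%:R / m ^+ 2) + 5000 * 1000 * m ^+ 8)) (x 0) (x n).
Proof.
have m1 := scale_ge1; have m0 : 0 < m := lt_le_trans ltr01 m1.
have u12 : cross (1, 0) u = u.2 /\ cross (0, 1) u = - u.1.
  by rewrite /cross; move: u => y /=; split; ring.
have g1 : bypassable (R := R) net x n (near_grid (1, 0)) (1400 * (n%:R / m ^+ 2) + 1400 * 1000 * m).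
  by apply: bypass_grid_lines; right; rewrite u12.1.
have g2 : bypassable (R := R) net x n (near_grid (0, 1)) (1400 * (n%:R / m ^+ 2) + 1400 * 1000 * m).
  by apply: bypass_grid_lines; left; rewrite u12.2 normrN.
have g3 : bypassable (R := R) net x n
    [set t | exists2 f, f \in crossing_families & near_line f t]
    ((size crossing_families)%:R * (72 * (n%:R / m ^+ 5) + 2000 * m ^+ 5)).
  apply: bypassable_bigcup => -[i h]; rewrite mem_filter => /andP[/andP[hi /eqP neq]].
  move=> /allpairsP[[i' h'] [/= i'j _ [ei eh]]]; apply: bypass_crossing_lines => //.
  by move: i'j; rewrite -ei mem_iota addnn -mul2n.
apply: (@reach_weak _ _ _ _ _ _ _ _ (bypassable_reach _ _ _ _ _
  (bypassableU _ _ _ _ _ _ _ (bypassableU _ _ _ _ _ _ _ bypass_long_chords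
    (bypassableU _ _ _ _ _ _ _ g1 g2)) g3) travel_step)).
rewrite lerD2l.
have N0 : 0 <= n%:R :> R by [].
have m2 : 0 < m ^+ 2 by rewrite exprn_gt0.
have pow (p q : nat) : (p <= q)%N -> m ^+ p <= m ^+ q by move=> pq; rewrite ler_weXn2l.
have K : (2 * n%:R / side (2 * j) + 6) * (120 * side j) = 240 * (n%:R / m ^+ 2) + 720 * m ^+ 2.
  have -> : side (2 * j) = m ^+ 2 * m ^+ 2 by rewrite /side mulnC exprM -/(side j) side_sqr expr2.
  by rewrite side_sqr; field; rewrite gt_eqF.
have L : (size crossing_families)%:R * (72 * (n%:R / m ^+ 5) + 2000 * m ^+ 5) <=
    1008 * (n%:R / m ^+ 2) + 28 * 1000 * m ^+ 8.
  apply: (@le_trans _ _ (14 * m ^+ 3 * (72 * (n%:R / m ^+ 5) + 2000 * m ^+ 5))).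
    apply: ler_wpM2r.
      apply: addr_ge0; apply: mulr_ge0; rewrite ?ler0n //; last by rewrite ltW ?exprn_gt0.
      by rewrite divr_ge0 // ltW ?exprn_gt0.
    have -> : 14 * m ^+ 3 = (14 * (2 ^ j) ^ 3)%N%:R by rewrite natrM !natrX.
    by rewrite ler_nat size_crossing_families.
  have -> : 14 * m ^+ 3 * (72 * (n%:R / m ^+ 5) + 2000 * m ^+ 5) =
      14 * 72 * (m ^+ 3 * (n%:R / m ^+ 5)) + 14 * 2000 * (m ^+ 3 * m ^+ 5) by ring.
  have -> : m ^+ 3 * (n%:R / m ^+ 5) = n%:R / m ^+ 2 by field; rewrite gt_eqF.
  by rewrite -exprD; lra.
rewrite K; have p1 := pow 1%N 8%N isT; have p2 := pow 2%N 8%N isT.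
have nm : 0 <= n%:R / m ^+ 2 by rewrite divr_ge0 // ltW.
rewrite expr1 in p1; lra.
Qed.

End TravelAlongLine.

(** * Travel between arbitrary points *)

Section TwoHeadings.
Context {R : realType}.
Implicit Types (z : R * R).

(* Between the slopes b and b + 2, concavity of the square root bounds the loss
   by the excess of the interpolated square, which is at most 1. *)
Lemma interpolate_slopes (m s b : R) : 1 <= m -> b <= s <= b + 2 ->
  (1 - (s - b) / 2) * norm2 (m, b) + (s - b) / 2 * norm2 (m, b + 2) <=
  norm2 (m, s) + (2 * m)^-1.
Proof.
move=> m1 /andP[bs sb]; set w := (s - b) / 2.
have w0 : 0 <= w by rewrite /w; lra.
have w1 : w <= 1 by rewrite /w; lra.
have N : m <= norm2 (m, s) by apply: norm2_ge; rewrite /= lerDl sqr_ge0.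
have N0 : 0 < norm2 (m, s) by apply: lt_le_trans N; lra.
have tangent c : norm2 (m, c) <= norm2 (m, s) + (c ^+ 2 - s ^+ 2) / (2 * norm2 (m, s)).
  have e1 := sqr_norm2 (m, c); have e2 := sqr_norm2 (m, s).
  have c0 := norm2_ge0 (m, c); rewrite /= in e1 e2.
  rewrite -lerBlDl ler_pdivlMr ?mulr_gt0 //.
  have := sqr_ge0 (norm2 (m, c) - norm2 (m, s)).
  by nra.
have t1 := tangent b; have t2 := tangent (b + 2).
have e : (1 - w) * (b ^+ 2 - s ^+ 2) + w * ((b + 2) ^+ 2 - s ^+ 2) <= 1.
  have -> : b = s - 2 * w by rewrite /w; field.
  by have := sqr_ge0 (2 * w - 1); nra.
have e' : ((1 - w) * (b ^+ 2 - s ^+ 2) + w * ((b + 2) ^+ 2 - s ^+ 2)) / (2 * norm2 (m, s)) <= (2 * m)^-1.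
  apply: (@le_trans _ _ (1 / (2 * norm2 (m, s)))).
    by rewrite ler_pM2r // invr_gt0 mulr_gt0.
  by rewrite mul1r lef_pV2 ?posrE ?mulr_gt0 ?ler_pM2l //; lra.
have w1' : 0 <= 1 - w by lra.
have h1 := ler_wpM2l w1' t1; have h2 := ler_wpM2l w0 t2.
move: h1 h2 e'; rewrite mulrDl; lra.
Qed.

Lemma norm2_swap (a b : R) : norm2 (a, b) = norm2 (b, a).
Proof. by rewrite /norm2 /= addrC. Qed.

Lemma norm2_scale (c a b : R) : norm2 (c * a, c * b) = `|c| * norm2 (a, b).
Proof. by rewrite /norm2 /= !exprMn -mulrDr sqrtrM ?sqr_ge0 // sqrtr_sqr. Qed.

Lemma is_heading_odd (j : nat) (flip : bool) (f : int) : (0 < j)%N ->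
  - (2 ^ j)%N%:Z - 2 <= 2 * f + 1 <= (2 ^ j)%N%:Z ->
  is_heading j (flip, 2 * f + 1) /\ is_heading j (flip, 2 * f + 1 + 2).
Proof.
move=> j0; have j2 : (2 <= 2 ^ j)%N by rewrite -[leqLHS]expn1 leq_exp2l.
by rewrite /is_heading j0 /=; move: (2 ^ j)%N j2 => q; clear; lia.
Qed.

(** The vector is x / m times (m, s) with |s| <= m, and (m, s) is interpolated between the headings
    of slopes b and b + 2. The loss |x| / m times 1 / (2 m) is second order. *)
Lemma decompose_flat (j : nat) (x y : R) : (0 < j)%N -> `|y| <= `|x| ->
  exists (b : int) (al be : R),
    [/\ is_heading j (false, b), is_heading j (false, b + 2),
        al * 2 ^+ j + be * 2 ^+ j = x, al * b%:~R + be * (b + 2)%:~R = y &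
        `|al| * norm2 (2 ^+ j, b%:~R) + `|be| * norm2 (2 ^+ j, (b + 2)%:~R) <=
        norm2 (x, y) + norm2 (x, y) / (2 ^+ j) ^+ 2].
Proof.
move=> j0 yx; set m : R := 2 ^+ j.
have m1 : 2 <= m by rewrite /m -[leLHS]expr1 ler_weXn2l ?ler1n.
have m0 : 0 < m by apply: lt_le_trans m1.
(* If x = 0 then y = 0 as well, so the default value 0 is correct. *)
pose s := if x == 0 then 0 else m * y / x.
have ys : y = (x / m) * s.
  rewrite /s; case: eqP => [x0|/eqP x0]; last by field; rewrite x0 gt_eqF.
  by move: yx; rewrite x0 normr0 normr_le0 => /eqP ->; rewrite mulr0.
have sm : `|s| <= m.
  rewrite /s; case: eqP => [_|/eqP x0]; first by rewrite normr0 ltW.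
  rewrite !normrM normfV (gtr0_norm m0) ler_pdivrMr ?normr_gt0 //.
  by rewrite ler_wpM2l // ltW.
(* [b] is the largest odd integer not exceeding [s]. *)
pose f := Num.floor ((s - 1) / 2); pose b : int := 2 * f + 1.
have bE : b%:~R = 2 * f%:~R + 1 :> R by rewrite /b intrD intrM.
have bs : b%:~R <= s <= b%:~R + 2.
  have := floor_itv ((s - 1) / 2); rewrite -/f bE !intrD => /andP[h1 h2].
  by apply/andP; split; lra.
have pow2 : 2 ^+ j = (2 ^ j)%N%:Z%:~R :> R by rewrite -[RHS]pmulrn natrX.
have [bl bu] : - (2 ^ j)%N%:Z - 2 <= b /\ b <= (2 ^ j)%N%:Z.
  move: sm bs; rewrite ler_norml /m pow2 => /andP[s1 s2] /andP[b1 b2]; split.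
    by rewrite -(ler_int R) intrD !intrN; lra.
  by rewrite -(ler_int R); lra.
have [hd1 hd2] : is_heading j (false, b) /\ is_heading j (false, b + 2).
  by apply: is_heading_odd => //; rewrite -/b bl bu.
pose w := (s - b%:~R) / 2; pose c := x / m.
exists b, (c * (1 - w)), (c * w); split=> //.
- by rewrite /c; field; rewrite gt_eqF.
- by rewrite [RHS]ys intrD /w -/c; field.
have w0 : 0 <= w by rewrite /w; lra.
have w1 : 0 <= 1 - w by rewrite /w; lra.
have -> : (b + 2)%:~R = b%:~R + 2 :> R by rewrite intrD.
rewrite (normrM c (1 - w)) (normrM c w) (ger0_norm w0) (ger0_norm w1) -[X in X + _]mulrA -[X in _ + X]mulrA -mulrDr.
have zE : norm2 (x, y) = `|c| * norm2 (m, s).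
  by rewrite -norm2_scale {1}ys /c divfK // gt_eqF.
have m1' : 1 <= m by lra.
apply: le_trans (ler_wpM2l (normr_ge0 c) (interpolate_slopes m s b%:~R m1' bs)) _.
rewrite mulrDr -zE lerD2l.
have cx : `|c| <= norm2 (x, y) / m.
  rewrite /c normrM normfV (gtr0_norm m0) ler_pM2r ?invr_gt0 //.
  apply: norm2_ge; rewrite real_normK ?num_real //= lerDl sqr_ge0 //.
apply: (@le_trans _ _ (norm2 (x, y) / m * m^-1)).
  apply: ler_pM => //; first by rewrite invr_ge0 mulr_ge0 // ltW.
  by rewrite lef_pV2 ?posrE ?mulr_gt0 //; lra.
by rewrite -mulrA -invfM expr2.
Qed.

(* Between neighbouring headings of level j the detour is second order in the
   angle 2^(- j). *)
Lemma decompose_heading (j : nat) z : (0 < j)%N ->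
  exists (g h : bool * int) (al be : R), let v := emb (heading j g) in let w := emb (heading j h) in
    [/\ is_heading j g, is_heading j h,
        z = (al * v.1 + be * w.1, al * v.2 + be * w.2) &
        `|al| * norm2 v + `|be| * norm2 w <= norm2 z + norm2 z / (2 ^+ j) ^+ 2].
Proof.
move=> j0; case: z => x y.
have pow2 : 2 ^+ j = (2 ^ j)%N%:Z%:~R :> R by rewrite -[RHS]pmulrn natrX.
have [yx|/ltW xy] := leP `|y| `|x|.
  have [b [al [be [h1 h2 e1 e2 h3]]]] := decompose_flat _ _ _ j0 yx.
  exists (false, b), (false, b + 2), al, be => v w.
  by rewrite /v /w /emb /heading /= -pow2 e1 e2; split.
have [b [al [be [h1 h2 e1 e2 h3]]]] := decompose_flat _ _ _ j0 xy.
exists (true, b), (true, b + 2), al, be => v w.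
rewrite /v /w /emb /heading /= -pow2 e1 e2; split=> //.
by rewrite !(norm2_swap _ (2 ^+ j)) (norm2_swap x).
Qed.

End TwoHeadings.

Section ChordNetworkUpperBound.
Context {R : realType} (J : nat) (built : chord_id -> Prop).
Hypothesis builtE : forall c,
  built c <-> valid J c /\ forall d, preferred J d c -> built d -> ~ obstructs (R := R) c d.

Local Notation net := (chord_network (R := R) built).
Implicit Types (x y : R * R).

Variable j : nat.
Hypotheses (j0 : (0 < j)%N) (jJ : (j <= J)%N).

Let m : R := 2 ^+ j.

Let travel_cost (A : R) : R := A + 1 + (5000 * ((A + 1) / m ^+ 2) + 5000 * 1000 * m ^+ 8).

(** Both ends have the same value of [cross v], so a single line of level j passes within m^7 of
    both; it is followed between the rounded projections. *)
Lemma travel_segment g x y (al : R) : is_heading j g ->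
  let v := emb (heading j g) in y = (x.1 + al * v.1, x.2 + al * v.2) ->
  exists p q, [/\ norm2 (emb p - x) <= m ^+ 7 + 4, norm2 (emb q - y) <= m ^+ 7 + 4 &
    reach (R := R) net (travel_cost (`|al| * norm2 v)) p q].
Proof.
move=> hg v yE; have [k hk] := exists_line R v x j.
pose l : line_id := (j, g, k).
have hl : is_heading l.1.1 l.1.2 by [].
have vE : line_vec l = v by [].
have N0 : 0 < norm2 v by rewrite -vE line_vec_norm_gt0.
have m0 : 0 < m by rewrite exprn_gt0.
have cy : cross v y = cross v x by rewrite yE /cross /=; clearbody v; ring.
have dy : dot (line_dir l) y = dot (line_dir l) x + al * norm2 v.
  have uu := line_dir_unit (R := R) l.
  have [e1 e2] : v.1 = norm2 v * (line_dir l).1 /\ v.2 = norm2 v * (line_dir l).2.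
    rewrite /line_dir vE; clearbody v; rewrite /= ![norm2 v * _]mulrC !divfK ?gt_eqF //.
  rewrite yE e1 e2; move: (line_dir l) (norm2 v) uu => u N uu; rewrite /dot /=.
  have -> : al * N = al * N * (u.1 ^+ 2 + u.2 ^+ 2) by rewrite uu mulr1.
  by ring.
set t := Num.floor (dot (line_dir l) x); set t' := Num.floor (dot (line_dir l) y).
have near z : `|cross v z - k%:~R * spacing j| <= spacing j ->
    norm2 (emb (line_road (R := R) l (Num.floor (dot (line_dir l) z))) - z) <= m ^+ 7 + 4.
  move=> hz; have := line_approx l z hz; rewrite dist2C -/m.
  move: (Num.floor _) => s; have := line_road_near l hl s (R := R).
  by have := ler_dist2 (emb (line_road (R := R) l s)) (on_line l s) z; lra.
exists (line_road (R := R) l t), (line_road (R := R) l t'); split; first exact: near.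
  by apply: near; rewrite cy.
have tt : `|t - t'|%:~R <= `|al| * norm2 v + 1.
  have -> : `|al| * norm2 v = `|al * norm2 v| by rewrite normrM (gtr0_norm N0).
  have := floor_itv (dot (line_dir l) x); have := floor_itv (dot (line_dir l) y).
  rewrite -/t -/t' dy !intrD => /andP[h1 h2] /andP[h3 h4].
  rewrite intr_norm intrB ler_norml; apply/andP.
  by have := ler_norm (al * norm2 v); have := ler_norm (- (al * norm2 v)); rewrite normrN; split; lra.
have travel (s s' : int) : s <= s' -> `|s - s'|%:~R <= `|al| * norm2 v + 1 ->
    reach (R := R) net (travel_cost (`|al| * norm2 v)) (line_road (R := R) l s) (line_road (R := R) l s').
  move=> ss; have [n sE] : exists n : nat, s' = s + n%:Z by exists (absz (s' - s)); lia.
  have -> : `|s - s'|%:~R = n%:R :> R by rewrite sE -[s in s - _]addr0 -[0]/(0%:Z) dist_shift // subn0.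
  move=> nA; have := line_travel _ _ builtE l hl jJ s n; rewrite /= addr0 -sE; apply: reach_weak.
  have step : n%:R / m ^+ 2 <= (`|al| * norm2 v + 1) / m ^+ 2 by rewrite ler_pM2r // invr_gt0 exprn_gt0.
  by apply: lerD; [exact: nA | rewrite lerD2r; apply: ler_wpM2l; [exact: ler0n | exact: step]].
have [h|h] := leP t t'; first exact: travel.
apply: reach_sym (chord_network_sym _) _; apply: travel; first exact: ltW.
by rewrite distrC.
Qed.

Lemma chord_network_upper p q : let D := norm2 (emb p - emb q : R * R) in
  reach (R := R) net (D + (11 * 1000 * (D / m ^+ 2) + 11 * 1000 * 1000 * m ^+ 8)) p q.
Proof.
move=> D; have [g [h [al [be [hg hh zE cost]]]]] := decompose_heading j (emb q - emb p : R * R) j0.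
set v := emb (heading j g) in zE cost; set w := emb (heading j h) in zE cost.
rewrite dist2C -/D -/m in cost.
pose x := emb p : R * R; pose z := emb q : R * R.
pose y := (x.1 + al * v.1, x.2 + al * v.2).
have zy : z = (y.1 + be * w.1, y.2 + be * w.2).
  rewrite -[z](subrKC x) zE /y; clearbody v w x; case: x {y} => a b.
  by congr pair => /=; ring.
have [p1 [q1 [np1 nq1 r1]]] := travel_segment g x y al hg erefl.
have [p2 [q2 [np2 nq2 r2]]] := travel_segment h y z be hh zy.
have m1 : 1 <= m by rewrite exprn_ege1 // ler1n.
have m0 : 0 < m by apply: lt_le_trans m1.
have close := chord_network_reach (R := R) built.
have dpp : norm2 (emb p - emb p1 : R * R) <= m ^+ 7 + 4 by rewrite dist2C.
have dqp : norm2 (emb q1 - emb p2 : R * R) <= 2 * (m ^+ 7 + 4).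
  by have := ler_dist2 (emb q1) y (emb p2); rewrite (dist2C y (emb p2)); lra.
(* The route runs along two lines and turns near [y]; the three hops between points and roads use
   the slow graph and cost O(m^7). *)
have := reach_trans _ _ _ _ _ _ (close p p1) (reach_trans _ _ _ _ _ _ r1
  (reach_trans _ _ _ _ _ _ (close q1 p2) (reach_trans _ _ _ _ _ _ r2 (close q2 q)))).
apply: reach_weak; rewrite /travel_cost -/v -/w.
have D0 : 0 <= D by exact: norm2_ge0.
have A0 : 0 <= `|al| * norm2 v by rewrite mulr_ge0 ?norm2_ge0.
have B0 : 0 <= `|be| * norm2 w by rewrite mulr_ge0 ?norm2_ge0.
have mm : 1 <= m ^+ 2 by rewrite exprn_ege1.
have im : 0 < (m ^+ 2)^-1 <= 1 by rewrite invr_gt0 (lt_le_trans ltr01) //= invf_le1 // (lt_le_trans ltr01).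
have p7 : m ^+ 7 <= m ^+ 8 by rewrite ler_weXn2l.
have p8 : 1 <= m ^+ 8 by rewrite exprn_ege1.
move: (`|al| * norm2 v) (`|be| * norm2 w) (norm2 (emb p - emb p1)) (norm2 (emb q1 - emb p2))
  (norm2 (emb q2 - emb q)) (m ^+ 7) (m ^+ 8) ((m ^+ 2)^-1) A0 B0 im p7 p8 cost dpp dqp nq2
  => A B d1 d2 d3 m7 m8 i A0 B0 /andP[i0 i1] p7 p8 cost d1' d2' d3'.
have h1 : (A + 1) * i + (B + 1) * i <= 2 * (D * i) + 2 * i.
  have -> : (A + 1) * i + (B + 1) * i = (A + B) * i + 2 * i by ring.
  rewrite lerD2r; apply: (@le_trans _ _ ((D + D * i) * i)); first by rewrite ler_pM2r.
  have : D * i * i <= D * i by rewrite ler_piMr // mulr_ge0 // ltW.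
  by rewrite mulrDl; lra.
have h2 : 0 <= D * i by rewrite mulr_ge0 // ltW.
lra.
Qed.

End ChordNetworkUpperBound.

(** * The limit graph *)

Section UltraLimit.
Context {V : eqType} (U : set_system nat) (e : nat -> rel V) (nbrs : V -> seq V).
Hypothesis uU : UltraFilter U.
Hypothesis e_nbrs : forall J p q, e J p q -> q \in nbrs p.

Definition limit_adj (p q : V) : bool := `[< U [set J | e J p q] >].

(** An ultrafilter containing a finite union contains one of its members. *)
Lemma ultra_exists (I : eqType) (r : seq I) (P : I -> set nat) :
  U [set J | exists2 i, i \in r & P i J] -> exists2 i, i \in r & U (P i).
Proof.
elim: r => [|i r IHr] h; first by have [J [? //]] := filter_ex h.
have [Pi|nPi] := in_ultra_setVsetC (P i) uU; first by exists i; rewrite ?mem_head.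
have [|k kr Pk] := IHr; last by exists k; rewrite // inE kr orbT.
apply: filterS (filterI h nPi) => J [[k]]; rewrite inE => /orP[/eqP ->|kr] Pk nk //.
by exists k.
Qed.

Lemma limit_path_eventually p s : path limit_adj p s -> U [set J | path (e J) p s].
Proof.
elim: s p => [p _|q s IHs p] /=; first exact: filterS filterT.
by move=> /andP[/asboolP pq /IHs qs]; apply: filterS (filterI pq qs) => J /= [-> ->].
Qed.

(** A compactness argument: the first step has finitely many possible targets, so one of them serves
    for [U]-almost all J, and induction continues from there. *)
Lemma limit_walk (n : nat) p q :
  U [set J | exists s, [/\ path (e J) p s, last p s = q & (size s <= n)%N]] ->
  exists s, [/\ path limit_adj p s, last p s = q & (size s <= n)%N].
Proof.
elim: n p => [|n IHn] p h.
  have [J [s [_ ls ss]]] := filter_ex h; exists [::]; split=> //.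
  by case: s ls ss.
have [<-|pq] := eqVneq p q; first by exists [::].
have [|r _ rU] := @ultra_exists _ (nbrs p) (fun r => [set J | e J p r /\
    exists s, [/\ path (e J) r s, last r s = q & (size s <= n)%N]]).
  apply: filterS h => J [[|r s] [/= ps ls ss]]; first by rewrite ls eqxx in pq.
  by case/andP: ps => pr ps; exists r; [exact: e_nbrs pr | split=> //; exists s].
have [|s [ps ls ss]] := IHn r.
  by apply: filterS rU => J [].
exists (r :: s); split=> //=; rewrite ps andbT; apply/asboolP.
by apply: filterS rU => J [].
Qed.

End UltraLimit.

Section GraphDistanceBounds.
Context {R : realType} {V : eqType} (G : sgraph V).

Lemma graph_dist_le (c : R) p q : reach (adj G) c p q -> (graph_dist R G p q <= c%:E)%E.
Proof.
move=> [s [ps ls sc]]; rewrite -ls; case/shortenP: ps => t pt ut ts.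
apply: ge_ereal_inf; exists (size t)%:R%:E; first by exists t.
by rewrite lee_fin (le_trans _ sc) // ler_nat uniq_leq_size //; case/andP: ut.
Qed.

Lemma graph_dist_ge (c : R) p q :
  (forall s, path (adj G) p s -> last p s = q -> c <= (size s)%:R) ->
  (c%:E <= graph_dist R G p q)%E.
Proof.
by move=> h; apply: le_ereal_inf_tmp => _ [s [ps ls _] <-]; rewrite lee_fin h.
Qed.

End GraphDistanceBounds.

Lemma exists_chord_networks (R : realType) : exists built : nat -> chord_id -> Prop,
  forall J c, built J c <-> valid J c /\
    forall d, preferred J d c -> built J d -> ~ obstructs (R := R) c d.
Proof.
have [f hf] := @choice _ _ (fun (J : nat) (A : chord_id -> Prop) => forall c, A c <-> valid J c /\
    forall d, preferred J d c -> A d -> ~ obstructs (R := R) c d)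
  (fun J => wf_kernel _ _ (valid J) (obstructs (R := R)) (preferred_wf J)).
by exists f.
Qed.

Definition king_moves (p : int * int) : seq (int * int) :=
  [seq (p.1 + a, p.2 + b) | a <- [:: -1; 0; 1], b <- [:: -1; 0; 1]].

Lemma king_movesP p q : king p q -> q \in king_moves p.
Proof.
case: p q => a b [c d] /and3P[_ /= h1 h2]; apply/allpairsP; exists (c - a, d - b) => /=.
split; last by congr pair; lia.
  by rewrite !inE; lia.
by rewrite !inE; lia.
Qed.

Lemma king_norm2 (R : realType) p q : king p q -> norm2 (emb p - emb q : R * R) <= 2.
Proof.
case/and3P => _ h1 h2; apply: le_trans (norm2_le_taxi_emb p q) _.
by rewrite -[2]/(2%:~R) ler_int /taxi; lia.
Qed.

(** The first three properties involve finitely many edges at a time, all present in one common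
    approximating graph. The upper bound holds whenever [j <= J] and passes to the limit by
    [limit_walk]. *)
Lemma exists_planar_network (R : realType) : exists H : sgraph (int * int),
  [/\ forall p q, adj H p q -> king p q, no_crossing (adj H),
      forall p s, path (adj H) p s -> norm2 (emb p - emb (last p s)) - 6 <= (size s)%:R :> R &
      forall j p q, (0 < j)%N -> let D := norm2 (emb p - emb q : R * R) in
        reach (adj H) (D + (11 * 1000 * (D / (2 ^+ j) ^+ 2) + 11 * 1000 * 1000 * (2 ^+ j) ^+ 8)) p q].
Proof.
have [built builtE] := exists_chord_networks R.
pose e J := chord_network (R := R) (built J).
have [U [uU sub]] := ultraFilterLemma (F := \oo) _.
have eU p q : reflect (U [set J | e J p q]) (limit_adj U e p q) by exact: asboolP.
have Hk p q : limit_adj U e p q -> king p q.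
  by move=> /eU /filter_ex [J]; exact: chord_network_king (builtE J) _ _.
have Hsym : symmetric (limit_adj U e).
  move=> p q; apply/eU/eU; apply: filterS => J /=; by rewrite /e chord_network_sym.
have Hirr : irreflexive (limit_adj U e).
  by move=> p; apply/negP => /Hk /and3P[/eqP].
exists (SGraph Hsym Hirr); split=> //=.
- move=> x y /eU h1 /eU h2; have [J [e1 e2]] := filter_ex (filterI h1 h2).
  exact: chord_network_no_crossing (builtE J) _ _ e1 e2.
- move=> p s /(limit_path_eventually _ _ uU) /filter_ex [J ps].
  exact: chord_network_path (builtE J) _ _ ps.
move=> j p q j0; set c := (X in reach _ X).
have c0 : 0 <= c.
  have D0 : 0 <= norm2 (emb p - emb q : R * R) by exact: norm2_ge0.
  have m0 k : 0 < (2 ^+ j) ^+ k :> R by rewrite !exprn_gt0.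
  have X0 := divr_ge0 D0 (ltW (m0 2%N)); have Y0 := ltW (m0 8%N).
  by rewrite /c; lra.
(* Lengths of walks are integers, so the budget may be replaced by its integer part. *)
have [|s [ps ls ss]] := limit_walk U e king_moves uU
    (fun J p q h => king_movesP _ _ (chord_network_king _ _ (builtE J) _ _ h)) (Num.trunc c) p q.
  have : U [set J | (j <= J)%N] by apply: sub; exact: nbhs_infty_ge.
  apply: filterS => J jJ; have [s [ps ls sc]] := chord_network_upper J _ (builtE J) j j0 jJ p q.
  by exists s; split=> //; rewrite truncn_ge_nat.
exists s; split=> //; by rewrite (@le_trans _ _ (Num.trunc c)%:R) ?ler_nat ?truncn_le.
Qed.

(** * Choice of the level and size of the error *)

Lemma dyadic_scale (R : realType) (j1 : nat) (d : R) : (0 < j1)%N -> 2 ^+ (10 * j1) <= d ->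
  exists j, [/\ (j1 <= j)%N, 2 ^+ (10 * j) <= d & d < 2 ^+ (10 * j.+1)].
Proof.
move=> j1_gt0 dj1; have ex : exists k, d < 2 ^+ (10 * k).
  exists (Num.trunc d).+1; apply: (@lt_trans _ _ (2 ^+ (Num.trunc d).+1)).
    apply: lt_trans (truncnS_gt d) _; rewrite -natrX ltr_nat; exact: ltn_expl.
  by rewrite ltr_eXn2l ?ltr1n //; lia.
case: (ex_minnP ex) => [[|j]] dj mini.
  have : 2 ^+ (10 * 0) <= d by apply: le_trans dj1; rewrite ler_weXn2l ?ler1n //; lia.
  by rewrite leNgt dj.
exists j; split=> //; last first.
  by rewrite leNgt; apply/negP => /mini; rewrite ltnn.
rewrite leqNgt; apply/negP => jj1; have : d < d.
  by apply: lt_le_trans dj _; apply: le_trans dj1; rewrite ler_weXn2l ?ler1n //; lia.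
by rewrite ltxx.
Qed.

Lemma exists_large_exponent (R : realType) (c : R) : exists j, (0 < j)%N /\ c <= 2 ^+ j.
Proof.
exists (Num.trunc c).+1; split=> //; apply: ltW; apply: lt_trans (truncnS_gt c) _.
by rewrite -natrX ltr_nat; exact: ltn_expl.
Qed.

(* With y = d^(1/6), the claim reads C y <= eta 4^j, whose cube follows from
   y^6 < 2^(10 (j + 1)). *)
Lemma error_small (R : realType) (C eta d : R) (j : nat) : 0 < C -> 0 < eta ->
  32 * (C / eta) ^+ 3 <= 2 ^+ j -> 1 <= d -> d < 2 ^+ (10 * j.+1) ->
  C * (d / (2 ^+ j) ^+ 2) <= eta * d `^ (5 / 6).
Proof.
move=> C0 eta0 hj d1 dlt; have d0 : 0 <= d by lra.
pose y := d `^ (1 / 6); have y0 : 0 <= y by exact: powR_ge0.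
have y6 : y ^+ 6 = d.
  rewrite -powR_mulrn // /y -powRrM (_ : 1 / 6 * 6%:R = 1) ?powRr1 //.
  by field.
have y5 : d `^ (5 / 6) = y ^+ 5.
  by rewrite -powR_mulrn // /y -powRrM; congr (_ `^ _); field.
have mn k : 0 < (2 ^+ j) ^+ k :> R by rewrite !exprn_gt0.
have y3 : y ^+ 3 <= 32 * (2 ^+ j) ^+ 5.
  have m5 : 0 <= 32 * (2 ^+ j) ^+ 5 :> R by rewrite mulr_ge0 ?(ltW (mn _)) ?ler0n.
  rewrite -(ler_pXn2r (n := 2)) ?nnegrE ?exprn_ge0 //.
  have -> : (y ^+ 3) ^+ 2 = d by rewrite -exprM; exact: y6.
  apply: le_trans (ltW dlt) _.
  have -> : (32 * (2 ^+ j) ^+ 5) ^+ 2 = 2 ^+ 10 * (2 ^+ j) ^+ 10 :> R by ring.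
  by rewrite mulnS exprD [X in 2 ^+ 10 * X]exprM exprAC.
set m : R := 2 ^+ j in hj mn y3 *; have m0 : 0 <= m by rewrite exprn_ge0.
have key : C * y <= eta * m ^+ 2.
  rewrite -(ler_pXn2r (n := 3)) ?nnegrE ?mulr_ge0 ?exprn_ge0 ?(ltW C0) ?(ltW eta0) //.
  have Cy : C ^+ 3 * y ^+ 3 <= C ^+ 3 * (32 * m ^+ 5) by rewrite ler_wpM2l // exprn_ge0 // ltW.
  rewrite exprMn (le_trans Cy) // exprMn.
  have e3 : 0 < eta ^+ 3 by rewrite exprn_gt0.
  have -> : C ^+ 3 * (32 * m ^+ 5) = eta ^+ 3 * (32 * (C / eta) ^+ 3 * m ^+ 5).
    by field; rewrite gt_eqF.
  have -> : (m ^+ 2) ^+ 3 = m * m ^+ 5 by rewrite -exprM -exprS.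
  by rewrite ler_pM2l // ler_pM2r.
rewrite y5 mulrA ler_pdivrMr //.
have -> : C * d = C * y * y ^+ 5 by rewrite -y6 exprS mulrA.
have -> : eta * y ^+ 5 * m ^+ 2 = eta * m ^+ 2 * y ^+ 5 by rewrite mulrAC.
by rewrite ler_wpM2r ?exprn_ge0.
Qed.

Theorem corollary5 (R : realType) :
  exists H' : sgraph (int * int)%type,
    [/\ planar R H',
        forall p q : int * int, adj H' p q -> eucl_dist R p q <= 2,
        exists K : R, forall p q : int * int,
          ((eucl_dist R p q - K)%:E <= graph_dist R H' p q)%E &
        forall eta : R, 0 < eta ->
          exists D : R, forall p q : int * int, D <= eucl_dist R p q ->
            (`| graph_dist R H' p q - (eucl_dist R p q)%:E |
               <= (eta * eucl_dist R p q `^ (5 / 6))%:E)%E].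
Proof.
have [H [Hk Hc lower upper]] := exists_planar_network R.
have low p q : ((eucl_dist R p q - 6)%:E <= graph_dist R H p q)%E.
  by apply: graph_dist_ge => s ps ls; rewrite eucl_distE -ls; exact: lower.
exists H; split.
- exact: king_planar.
- by move=> p q /Hk; rewrite eucl_distE; exact: king_norm2.
- by exists 6.
(* [C] is the sum of the two constants of the upper bound: as m^10 <= d, the term m^8 is at most d /
   m^2. *)
move=> eta eta0; pose C : R := 11 * 1000 * 1001.
have C0 : 0 < C by rewrite /C; lra.
have [j1 [j1_gt0 hj1]] := exists_large_exponent _ (32 * (C / eta) ^+ 3).
exists (2 ^+ (10 * j1)) => p q; have := low p q; have up := upper _ p q.
move: up; rewrite eucl_distE; set d := norm2 _ => up lo dj1.
have [j [jj dj ltd]] := dyadic_scale _ _ _ j1_gt0 dj1.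
have {}up := graph_dist_le _ _ _ _ (up j (leq_trans j1_gt0 jj)).
set m : R := 2 ^+ j in up.
have m1 : 1 <= m by rewrite exprn_ege1 // ler1n.
have mn k : 0 < m ^+ k by rewrite exprn_gt0 // (lt_le_trans ltr01).
have m10 : m ^+ 10 <= d by rewrite /m -exprM mulnC.
have d1 : 1 <= d by apply: le_trans m10; rewrite exprn_ege1.
have m8 : m ^+ 8 <= d / m ^+ 2 by rewrite ler_pdivlMr // -exprD.
have m8' : 1 <= m ^+ 8 by rewrite exprn_ege1.
have := error_small _ C eta d j C0 eta0 _ d1 ltd; rewrite -/m => /(_ _) err.
have {}err : C * (d / m ^+ 2) <= eta * d `^ (5 / 6).
  by apply: err; apply: le_trans hj1 _; rewrite ler_weXn2l ?ler1n.
have bound : d + (11 * 1000 * (d / m ^+ 2) + 11 * 1000 * 1000 * m ^+ 8) <= d + C * (d / m ^+ 2).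
  by rewrite /C; lra.
(* The additive loss of the lower bound is absorbed too, because d / m^2 >= m^8 >= 1. *)
have six : 6 <= C * (d / m ^+ 2).
  by rewrite /C; lra.
case: (graph_dist R H p q) up lo => [r| |] //.
rewrite !lee_fin => up lo; rewrite ler_norml.
by apply/andP; split; lra.
Qed.
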